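(* Consider the composite finite-sum problem and the single-loop variance-reduced acceleration algorithm (the ''Algorithm'') described in the context, with the parameter choices listed there ($\tau_t=1/\alpha_t$, $\xi=1/(bc)$, $\tilde\alpha_0\ge\xi\alpha_1^2$, $0<\eta\le1/(cL+L)$). Set $\alpha=1$ and let the mini-batch size $b\in[n]$ be of order $\sqrt n$. Then $$\lim_{t\to\infty}\mathbb{E}\left[F(y_t)-F(x^* )\right]=0,\qquad \lim_{t\to\infty}\mathbb{E}\left[F(w_t)-F(x^* )\right]=0,$$ and the expected IFO complexity of the Algorithm for reaching an $\epsilon$-accurate solution, $\epsilon\in(0,1)$, is $\widetilde{\mathcal{O}}(n+\sqrt n/\sqrt\epsilon)$, both when accuracy is measured along the sequence $\{\mathbb{E}[F(y_t)]\}_t$ and when it is measured along the sequence $\{\mathbb{E}[F(w_t)]\}_t$.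
   Context: Problem. $\min_{x\in\mathbb{R}^d}F(x):=f(x)+l(x)$ with $f(x)=\frac1n\sum_{i=1}^n f_i(x)$. Standing assumptions: (A1) there is a minimizer, and $x^*$ denotes a fixed one; (A2) each $f_i:\mathbb{R}^d\to\mathbb{R}$ is differentiable and $L$-smooth for some $L>0$: $f_i(y)\le f_i(x)+\langle\nabla f_i(x),y-x\rangle+\frac L2\|y-x\|^2$ for all $x,y$; (A3) each $f_i$ is convex; (A4) $l:\mathbb{R}^d\to(-\infty,+\infty]$ is proper, convex, lower semicontinuous (possibly non-differentiable) with an efficiently computable proximal operator. $\|\cdot\|$ is the Euclidean norm, $[n]=\{1,\dots,n\}$, $\mathbb{N}=\{0,1,2,\dots\}$, $\mathbb{N}^+=\{1,2,\dots\}$. Algorithm. Start from a deterministic point $w_1=x_1=y_1=z_1$ with $F(x_1)<\infty$. For $t=1,2,\dots$: - $x_{t+1}=\tau_t z_t+\xi w_t+(1-\xi-\tau_t)y_t$; - draw $J_t\subset[n]$ uniformly among all subsets of $[n]$ of cardinality $b$, independently of the past; - $\tilde g_{t+1}=\frac1b\sum_{j\in J_t}\left(\nabla f_j(x_{t+1})-\nabla f_j(w_t)\right)+\nabla f(w_t)$; - $z_{t+1}=\arg\min_{z\in\mathbb{R}^d}\left\{\frac{1}{2\alpha_t\eta}\|z-z_t\|^2+\langle\tilde g_{t+1},z\rangle+l(z)\right\}$; - $y_{t+1}=x_{t+1}+\tau_t(z_{t+1}-z_t)$; - $w_{t+1}=y_t$ with probability $p_t$ and $w_{t+1}=w_t$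 with probability $1-p_t$ (coin independent of everything else), where $$p_t=\frac{\alpha_{t-1}^2-\alpha_t^2+\alpha_t+\xi\alpha_t^2}{\tilde\alpha_0+\alpha_0^2-\alpha_t^2+\sum_{j=1}^t\alpha_j}.$$ Parameters (for $\alpha=1$). $\alpha_t=6$ for $0\le t\le 16$ and $\alpha_t=t/4$ for $t\ge17$; $c=\max\{2,\,b^{-1}\max\{6/5,(1-\alpha_{17}^{-1})^{-1}\}\}+1$ and $\xi=1/(bc)$. Cost model. One IFO (incremental first-order oracle) call returns $(f_i(x),\nabla f_i(x))$ for one index $i$ and one point $x$. A full gradient $\nabla f(w)$ costs $n$ calls and is computed at the start and each time the checkpoint $w$ is replaced; a mini-batch evaluation costs $\mathcal{O}(b)$ calls. Thus the expected cost of iteration $t$ is $\mathcal{O}(b+np_t)$. A (random) point $x$ is $\epsilon$-accurate if $\mathbb{E}[F(x)-F(x^* )]\le\epsilon$; the expected IFO complexity along a sequence ($y$ or $w$) is the expected number of IFO calls made over iterations $1,\dots,T(\epsilon)$, with $T(\epsilon)$ the smallest $T$ for which the iterate of that sequence with index $T+1$ is $\epsilon$-accurate. $\mathcal{O}$ convention. ''$b$ of order $\sqrt n$'' means $k_1\sqrt n\le b\le k_2\sqrt n$ for fixed absolute constants $0<k_1\le k_2$. Implied constants may depend only on $k_1,k_2$, $L$, $\eta$, $\tilde\alpha_0$, $F(x_1)-F(x^* )$ and $\|x_1-x^*\|$, and not on $n,\epsilon$. $\widetilde{\mathcal{O}}$ additionally hides factors logarithmic in $n$ and $1/\epsilon$.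 As usual, degenerate ranges where the logarithms vanish are excluded: $n\ge2$ and $\epsilon\in(0,\epsilon_0]$ for an arbitrary fixed $\epsilon_0<1$, on which the constant may also depend. *)

(* Defs.v *)
From HB Require Import structures.
From mathcomp Require Import all_boot all_order all_algebra finmap.
From mathcomp Require Import all_classical all_reals all_analysis.

Set Implicit Arguments.
Unset Strict Implicit.
Unset Printing Implicit Defensive.

Import Order.TTheory GRing.Theory Num.Theory.
Import numFieldNormedType.Exports.

Local Open Scope classical_set_scope.
Local Open Scope ring_scope.

Section Euclidean.
Context {R : realType} {d : nat}.
Implicit Types u v x : 'rV[R]_d.

Definition dotv u v : R := \sum_(j < d) u 0 j * v 0 j.

(* The library norm on 'rV[R]_d is the sup norm; it induces the same topology
   and the same notion of differentiability as this one. *)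
Definition enorm u : R := Num.sqrt (dotv u u).

Definition grad (g : 'rV[R]_d -> R) x : 'rV[R]_d :=
  \row_j 'D_(delta_mx 0 j) g x.

Definition is_argmin (G : 'rV[R]_d -> \bar R) x : Prop :=
  forall v, (G x <= G v)%E.

Definition proper_ereal (l : 'rV[R]_d -> \bar R) : Prop :=
  (forall x, l x != -oo%E) /\ (exists x, l x != +oo%E).

Definition convex_ereal (l : 'rV[R]_d -> \bar R) : Prop :=
  forall (u v : 'rV[R]_d) (s : R), 0 <= s -> s <= 1 ->
    (l (s *: u + (1 - s) *: v)%R <= s%:E * l u + (1 - s)%:E * l v)%E.

Definition smooth_with (L : R) (g : 'rV[R]_d -> R) : Prop :=
  forall u v,
    g v <= g u + dotv (grad g u) (v - u) + L / 2 * enorm (v - u) ^+ 2.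

End Euclidean.

Section Problem.
Context {R : realType} {n d : nat}.
Variables (f : 'I_n -> 'rV[R]_d -> R) (l : 'rV[R]_d -> \bar R).

Definition favg (x : 'rV[R]_d) : R := n%:R^-1 * \sum_(i < n) f i x.

Definition objective (x : 'rV[R]_d) : \bar R := ((favg x)%:E + l x)%E.

Record problem_assumptions (L : R) (xstar : 'rV[R]_d) : Prop := {
  xstar_minimizer : is_argmin objective xstar ;
  f_differentiable : forall i x, differentiable (f i) x ;
  f_smooth : forall i, smooth_with L (f i) ;
  f_convex : forall i, convex_function [set: convex_lmodType 'rV[R]_d] (f i) ;
  l_proper : proper_ereal l ;
  l_convex : convex_ereal l ;
  l_lsc : lower_semicontinuous l }.

End Problem.

Section Schedules.
Context {R : realType}.

Definition alpha (t : nat) : R := if (t <= 16)%N then 6 else t%:R / 4.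

Definition tau (t : nat) : R := (alpha t)^-1.

Definition cpar (b : nat) : R :=
  Num.max 2 (b%:R^-1 * Num.max (6 / 5) ((1 - (alpha 17)^-1)^-1)) + 1.

Definition xi (b : nat) : R := (b%:R * cpar b)^-1.

(* Meaningful for t >= 1 only; atil stands for \tilde\alpha_0. *)
Definition ckpt_prob (atil : R) (b t : nat) : R :=
  (alpha t.-1 ^+ 2 - alpha t ^+ 2 + alpha t + xi b * alpha t ^+ 2) /
  (atil + alpha 0 ^+ 2 - alpha t ^+ 2 + \sum_(1 <= j < t.+1) alpha j).

End Schedules.

Section Randomness.
Context {R : realType} {disp : measure_display} {T : measurableType disp}.
Variable P : probability T R.

Definition mutually_independent (I : choiceType) (A : set I)
    (G : I -> set (set T)) : Prop :=
  (forall i, A i -> G i `<=` measurable) /\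
  forall (B : {fset I}), [set` B] `<=` A ->
  forall E : I -> set T, (forall i, i \in B -> G i (E i)) ->
    P (\bigcap_(i in [set` B]) E i) = (\prod_(i <- B) P (E i))%E.

(* The sigma-algebra generated by a variable with values in a finite type. *)
Definition generated_by (V : finType) (X : T -> V) : set (set T) :=
  [set X @^-1` B | B in [set: set V]].

(* inl t is the index of the mini-batch J_t, inr t that of the coin of
   iteration t; iterations are numbered from 1. *)
Definition draws (n : nat) (J : nat -> T -> {set 'I_n})
    (coin : nat -> T -> bool) (i : nat + nat) : set (set T) :=
  match i with
  | inl t => generated_by (J t)
  | inr t => generated_by (coin t)
  end.

Record random_draws (n b : nat) (p : nat -> R) (J : nat -> T -> {set 'I_n})
    (coin : nat -> T -> bool) : Prop := {
  batch_uniform : forall t (A : {set 'I_n}), (1 <= t)%N ->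
    P (J t @^-1` [set A]) =
    (if #|A| == b then ('C(n, b)%:R^-1)%:E else 0%E) ;
  coin_law : forall t, (1 <= t)%N -> P (coin t @^-1` [set true]) = (p t)%:E ;
  draws_independent : mutually_independent
    [set i | (1 <= match i with inl t => t | inr t => t end)%N]
    (draws J coin) }.

End Randomness.

Section Algorithm.
Context {R : realType} {n d : nat} {T : Type}.
Variables (f : 'I_n -> 'rV[R]_d -> R) (l : 'rV[R]_d -> \bar R).

Definition grad_estimate (b : nat) (J : {set 'I_n}) (x w : 'rV[R]_d) :
    'rV[R]_d :=
  b%:R^-1 *: (\sum_(j in J) (grad (f j) x - grad (f j) w)) + grad (favg f) w.

Definition prox_objective (step : R) (z g v : 'rV[R]_d) : \bar R :=
  (((2 * step)^-1 * enorm (v - z) ^+ 2 + dotv g v)%:E + l v)%E.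

(* The values at index 0 of the iterates are irrelevant. *)
Record algorithm_run (b : nat) (eta : R) (x1 : 'rV[R]_d)
    (J : nat -> T -> {set 'I_n}) (coin : nat -> T -> bool)
    (x y z w : nat -> T -> 'rV[R]_d) : Prop := {
  start_finite : (objective f l x1 < +oo)%E ;
  start : forall o, [/\ x 1%N o = x1, y 1%N o = x1, z 1%N o = x1 & w 1%N o = x1] ;
  x_step : forall t o, (1 <= t)%N ->
    x t.+1 o = tau t *: z t o + xi b *: w t o + (1 - xi b - tau t) *: y t o ;
  z_step : forall t o, (1 <= t)%N ->
    is_argmin (prox_objective (alpha t * eta) (z t o)
                 (grad_estimate b (J t o) (x t.+1 o) (w t o)))
              (z t.+1 o) ;
  y_step : forall t o, (1 <= t)%N ->
    y t.+1 o = x t.+1 o + tau t *: (z t.+1 o - z t o) ;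
  w_step : forall t o, (1 <= t)%N ->
    w t.+1 o = if coin t o then y t o else w t o }.

End Algorithm.

Section Complexity.
Context {R : realType} {disp : measure_display} {T : measurableType disp}.
Variable P : probability T R.

Definition expected_gap (n d : nat) (f : 'I_n -> 'rV[R]_d -> R)
    (l : 'rV[R]_d -> \bar R) (xstar : 'rV[R]_d) (v : nat -> T -> 'rV[R]_d)
    (t : nat) : \bar R :=
  (\int[P]_o (objective f l (v t o) - objective f l xstar))%E.

(* N = 0 is allowed: then the starting point, the iterate of index 1, is
   already accurate and no iteration is charged. *)
Definition first_accurate (gapseq : nat -> \bar R) (eps : R) (N : nat) : Prop :=
  (gapseq N.+1 <= eps%:E)%E /\
  (forall M, (M < N)%N -> ~ (gapseq M.+1 <= eps%:E)%E).

(* Calls made up to the end of iteration N: the full gradient at w_1, then at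
   each iteration one call per index of the batch at each of x_{t+1} and w_t,
   and n calls for the full gradient at w_{t+1} when the checkpoint is
   replaced. *)
Definition ifo_calls (n b : nat) (coin : nat -> T -> bool) (N : nat) (o : T) :
    nat :=
  (n + \sum_(1 <= t < N.+1) (2 * b + (if coin t o then n else 0)))%N.

Definition expected_ifo_calls (n b : nat) (coin : nat -> T -> bool) (N : nat) :
    \bar R :=
  ('E_P[fun o => (ifo_calls n b coin N o)%:R : R])%E.

Definition ifo_complexity_le (n b : nat) (coin : nat -> T -> bool)
    (gapseq : nat -> \bar R) (eps bound : R) : Prop :=
  exists N, first_accurate gapseq eps N /\
            (expected_ifo_calls n b coin N <= bound%:E)%E.

End Complexity.

(* Main.v *)
Require Import Defs.
From HB Require Import structures.
From mathcomp Require Import all_boot all_order all_algebra finmap.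
From mathcomp Require Import ring lra.
From mathcomp Require Import all_classical all_reals all_analysis.

Set Implicit Arguments.
Unset Strict Implicit.
Unset Printing Implicit Defensive.

Import Order.TTheory GRing.Theory Num.Theory.
Import numFieldNormedType.Exports.

Local Open Scope classical_set_scope.
Local Open Scope ring_scope.

(** Weight the gaps of y_t and w_t and the squared distance of z_t to the
    minimizer into the potential

      alpha_{t-1}^2 D(y_t) + q_{t-1} D(w_t) + |z_t - xstar|^2 / (2 eta),

    where D is the gap F - min F and q_t is the denominator of p_t (so q_0 is
    \tilde\alpha_0). Smoothness at x_{t+1}, Young's inequality for the gradient
    noise and the three-point inequality of the proximal step bound its change;
    the variance of the noise is at most 2L/b times the Bregman distance of f
    between the checkpoint and x_{t+1}, and averaging over the batch makes this cancel against the weight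
    xi = 1/(bc) of the checkpoint. The formula for p_t is exactly what makes the
    expected potential nonincreasing. As alpha_t^2 and q_t are at least t^2/16,
    both expected gaps are O(1/t^2), hence the iteration count is
    O(1/sqrt eps); since p_t <= 3/t + xi for t >= 18, the expected number of
    full gradients over N iterations is O(1 + log N + N xi).

    The iterates at time t+1 are functions of the finitely many values of the
    first t draws (the proximal point is unique), so all expectations are finite
    sums over histories. *)

(** * Euclidean vectors, smooth convex functions, proximal steps *)

(** Replaces the limit s -> 0: after division by the step s, a first-order inequality holds up to a
    remainder of order s, which this removes. *)
Lemma le_of_small_perturbation (R : realType) (a b : R) :
  (forall s, 0 < s -> s <= 1 -> a <= b * s) -> a <= 0.
Proof.
move=> H; case: (ltP 0 a) => // a0.
have a1 : 0 < `|b| + 1 by apply: ltr_wpDl.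
(* If [a] were positive, this step would lie in (0,1] and give [b * s < a]. *)
have s0 : 0 < a / (a + (`|b| + 1)) by apply: divr_gt0 => //; lra.
have s1 : a / (a + (`|b| + 1)) <= 1 by rewrite ler_pdivrMr; lra.
have := H _ s0 s1; rewrite mulrA ler_pdivlMr; last lra.
have bb : b <= `|b| := ler_norm b.
nra.
Qed.

Section Vectors.
Context {R : realType} {d : nat}.
Implicit Types u v w x y : 'rV[R]_d.

Lemma dotvC u v : dotv u v = dotv v u.
Proof. by apply: eq_bigr => j _; rewrite mulrC. Qed.

Lemma dotvDl u v w : dotv (u + v) w = dotv u w + dotv v w.
Proof. by rewrite -big_split; apply: eq_bigr => j _; rewrite mxE mulrDl. Qed.

Lemma dotvZl a u w : dotv (a *: u) w = a * dotv u w.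
Proof. by rewrite mulr_sumr; apply: eq_bigr => j _; rewrite mxE mulrA. Qed.

Lemma dotvNl u w : dotv (- u) w = - dotv u w.
Proof. by rewrite -scaleN1r dotvZl mulN1r. Qed.

Lemma dotvDr u v w : dotv w (u + v) = dotv w u + dotv w v.
Proof. by rewrite dotvC dotvDl !(dotvC w). Qed.

Lemma dotvZr a u w : dotv w (a *: u) = a * dotv w u.
Proof. by rewrite dotvC dotvZl (dotvC w). Qed.

Lemma dotvNr u w : dotv w (- u) = - dotv w u.
Proof. by rewrite dotvC dotvNl (dotvC w). Qed.

Definition dotvE := (dotvDl, dotvDr, dotvNl, dotvNr, dotvZl, dotvZr).

Lemma dotv_suml (I : Type) (r : seq I) (p : pred I) (F : I -> 'rV[R]_d) w :
  dotv (\sum_(i <- r | p i) F i) w = \sum_(i <- r | p i) dotv (F i) w.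
Proof.
apply: (big_ind2 (fun a b => dotv a w = b)) => [|a b c e <- <-|//].
  by rewrite /dotv big1 // => j _; rewrite mxE mul0r.
by rewrite dotvDl.
Qed.

Lemma dotvv_ge0 u : 0 <= dotv u u.
Proof. by apply: sumr_ge0 => j _; rewrite -expr2 sqr_ge0. Qed.

Lemma enorm_sqr u : enorm u ^+ 2 = dotv u u.
Proof. by rewrite sqr_sqrtr // dotvv_ge0. Qed.

Lemma dotvv_le0 u : dotv u u <= 0 -> u = 0.
Proof.
move=> u0; apply/rowP => j; rewrite mxE; apply/eqP.
have /eqP : dotv u u = 0 by apply/eqP; rewrite eq_le u0 dotvv_ge0.
rewrite /dotv psumr_eq0 => [|i _]; last by rewrite -expr2 sqr_ge0.
by move=> /allP/(_ j (mem_index_enum _))/=; rewrite mulf_eq0 orbb.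
Qed.

(** Expansion of [0 <= |u - a v|^2], divided by [2 a]. *)
Lemma dotv_young u v (a : R) : 0 < a ->
  dotv u v <= (2 * a)^-1 * dotv u u + a / 2 * dotv v v.
Proof.
move=> a0; have := dotvv_ge0 (u - a *: v); rewrite !dotvE (dotvC v u).
move=> H.
have -> : (2 * a)^-1 * dotv u u + a / 2 * dotv v v = dotv u v +
  (2 * a)^-1 * (dotv u u + - (a * dotv u v) + (- (a * dotv u v) + - - (a * (a * dotv v v)))).
  by field; apply: lt0r_neq0.
by rewrite lerDl mulr_ge0 // ?invr_ge0; nra.
Qed.

Section SmoothConvex.
Variables (L : R) (g : 'rV[R]_d -> R).
Hypotheses (L0 : 0 < L) (smg : smooth_with L g).
Hypothesis cvxg : convex_function [set: convex_lmodType 'rV[R]_d] g.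

Lemma convex_functionE u v (s : R) : 0 <= s -> s <= 1 ->
  g (s *: u + (1 - s) *: v) <= s * g u + (1 - s) * g v.
Proof.
by move=> s0 s1; apply: (@cvxg (Itv01 s0 s1) u v); rewrite inE.
Qed.

(* Convexity at x, written as a combination of u and x - s (u - x), together
   with the smoothness upper bound at x - s (u - x), and s -> 0. *)
Lemma convex_first_order u x : g x + dotv (grad g x) (u - x) <= g u.
Proof.
rewrite -subr_le0.
apply: (@le_of_small_perturbation _ _ (L / 2 * dotv (u - x) (u - x))) => s s0 _.
have t0 : 0 < 1 + s by lra.
have q0 : 0 <= s / (1 + s) by rewrite divr_ge0; lra.
have q1 : s / (1 + s) <= 1 by rewrite ler_pdivrMr; lra.
have := convex_functionE u (x - s *: (u - x)) q0 q1.
have -> : s / (1 + s) *: u + (1 - s / (1 + s)) *: (x - s *: (u - x)) = x.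
  by apply/rowP => j; rewrite !mxE; field; apply: lt0r_neq0.
have := smg x (x - s *: (u - x)).
have -> : x - s *: (u - x) - x = - s *: (u - x).
  by apply/rowP => j; rewrite !mxE; ring.
rewrite enorm_sqr !dotvZl !dotvZr; set q := dotv (u - x) _; set h := dotv (grad g x) _.
move=> H1 H2.
have {}H2 : (1 + s) * g x <= s * g u + g (x - s *: (u - x)).
  have -> : s * g u + g (x - s *: (u - x)) =
    (1 + s) * (s / (1 + s) * g u + (1 - s / (1 + s)) * g (x - s *: (u - x))).
    by field; apply: lt0r_neq0.
  by rewrite ler_pM2l.
have : s * (g x + h - g u) <= s * (L / 2 * q * s) by nra.
by rewrite ler_pM2l.
Qed.

(** The affine minorant of [g] at [x] lies below its quadratic majorant at [u]. Both are evaluated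
    at [u + L^-1 e], the point where the majorant exceeds the minorant least. *)
Lemma cocoercive u x :
  dotv (grad g x - grad g u) (grad g x - grad g u) <=
  2 * L * (g u - g x - dotv (grad g x) (u - x)).
Proof.
set e := grad g x - grad g u.
have := convex_first_order (u + L^-1 *: e) x.
have := smg u (u + L^-1 *: e).
rewrite enorm_sqr.
have -> : u + L^-1 *: e - u = L^-1 *: e by rewrite addrC addKr.
have -> : u + L^-1 *: e - x = (u - x) + L^-1 *: e by rewrite addrAC.
have E : dotv (grad g x) (L^-1 *: e) = dotv (grad g u) (L^-1 *: e) + L^-1 * dotv e e.
  by rewrite -dotvZr -dotvDl /e addrCA subrr addr0.
rewrite dotvDr E !dotvZl !dotvZr => H1 H2.
have {H1 H2} := le_trans H2 H1.
set p := dotv (grad g u) e; set q := dotv e e => H.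
have : L^-1 * q / 2 <= g u - g x - dotv (grad g x) (u - x).
  move: H; have -> : L / 2 * (L^-1 * (L^-1 * q)) = L^-1 * q / 2 by field; apply: lt0r_neq0.
  set a := L^-1 * q; set c := L^-1 * p; lra.
rewrite -(@ler_pM2l _ (2 * L)); last by rewrite mulr_gt0.
by have -> : 2 * L * (L^-1 * q / 2) = q by field; apply: lt0r_neq0.
Qed.

End SmoothConvex.

(** * Proximal steps for an extended-valued convex function *)

Section Prox.
Variables (l : 'rV[R]_d -> \bar R).
Hypotheses (lp : proper_ereal l) (lc : convex_ereal l).

Lemma proper_fin x : (l x < +oo)%E -> l x = (fine (l x))%:E.
Proof. by move=> lx; rewrite fineK // fin_numElt lx ltNye (lp.1 x). Qed.

Lemma convex_fine u v (s : R) : 0 <= s -> s <= 1 ->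
  (l u < +oo)%E -> (l v < +oo)%E ->
  (l (s *: u + (1 - s) *: v) < +oo)%E /\
  fine (l (s *: u + (1 - s) *: v)) <= s * fine (l u) + (1 - s) * fine (l v).
Proof.
move=> s0 s1 lu lv; have := lc u v s0 s1.
rewrite (proper_fin lu) (proper_fin lv) -!EFinM -EFinD => H.
have F : (l (s *: u + (1 - s) *: v) < +oo)%E by rewrite (le_lt_trans H) ?ltry.
split=> //; rewrite -lee_fin -(proper_fin F); exact: H.
Qed.

Lemma convex_fine3 u v w (r s : R) : 0 <= r -> 0 <= s -> r + s < 1 ->
  (l u < +oo)%E -> (l v < +oo)%E -> (l w < +oo)%E ->
  (l (r *: u + s *: v + (1 - s - r) *: w) < +oo)%E /\
  fine (l (r *: u + s *: v + (1 - s - r) *: w)) <=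
    r * fine (l u) + s * fine (l v) + (1 - s - r) * fine (l w).
Proof.
move=> r0 s0 rs lu lv lw.
have t0 : 0 < 1 - r by lra.
have q0 : 0 <= s / (1 - r) by rewrite divr_ge0; lra.
have q1 : s / (1 - r) <= 1 by rewrite ler_pdivrMr; lra.
(* The points [v] and [w] are merged first, with their weights renormalised by [1 - r]; the result
   is then combined with [u]. *)
have [m1 m2] := convex_fine q0 q1 lv lw.
have r1 : r <= 1 by lra.
have [] := convex_fine r0 r1 lu m1.
have -> : r *: u + (1 - r) *: (s / (1 - r) *: v + (1 - s / (1 - r)) *: w) =
  r *: u + s *: v + (1 - s - r) *: w.
  by apply/rowP => j; rewrite !mxE; field; apply: lt0r_neq0.
move=> H1 H2; split=> //; apply: (le_trans H2); rewrite -addrA lerD2l.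
have -> : s * fine (l v) + (1 - s - r) * fine (l w) =
  (1 - r) * (s / (1 - r) * fine (l v) + (1 - s / (1 - r)) * fine (l w)).
  by field; apply: lt0r_neq0.
by rewrite ler_pM2l.
Qed.

Lemma argmin_prox_dom (s : R) z g zp u :
  is_argmin (prox_objective l s z g) zp -> (l u < +oo)%E -> (l zp < +oo)%E.
Proof.
move=> /(_ u) H lu; move: H; rewrite /prox_objective (proper_fin lu) -EFinD => H.
have := le_lt_trans H (ltry _).
by have := lp.1 zp; case: (l zp) => [r|//|//] _ _; rewrite ltry.
Qed.

(** The minimizer is compared with the nearby point [t u + (1 - t) zp]; convexity of [l], division
    by [t] and t -> 0 leave the first-order condition, rewritten with three squared distances. *)
Lemma prox_three_points (s : R) z g zp u : 0 < s ->
  is_argmin (prox_objective l s z g) zp -> (l u < +oo)%E ->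
  dotv g (zp - u) + fine (l zp) - fine (l u) <=
  (2 * s)^-1 * (dotv (z - u) (z - u) - dotv (zp - u) (zp - u)
                - dotv (zp - z) (zp - z)).
Proof.
move=> s0 am lu; have lz := argmin_prox_dom am lu.
rewrite -subr_le0.
apply: (@le_of_small_perturbation _ _ ((2 * s)^-1 * dotv (u - zp) (u - zp))) => t t0 t1.
have [m1 m2] := convex_fine (ltW t0) t1 lu lz.
have := am (t *: u + (1 - t) *: zp).
rewrite /prox_objective (proper_fin lz) (proper_fin m1) -!EFinD lee_fin.
move=> /le_trans/(_ (lerD (lexx _) m2)).
have -> : t *: u + (1 - t) *: zp = zp + t *: (u - zp).
  by apply/rowP => j; rewrite !mxE; ring.
rewrite !enorm_sqr.
have -> : zp + t *: (u - zp) - z = (zp - z) + t *: (u - zp) by rewrite addrAC.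
have -> : z - u = - ((u - zp) + (zp - z)) by rewrite addrA subrK opprB.
have -> : zp - u = - (u - zp) by rewrite opprB.
move: (u - zp) (zp - z) => e h.
rewrite !dotvE (dotvC h e).
have : 0 < (2 * s)^-1 by rewrite invr_gt0 mulr_gt0.
move: (dotv g e) (dotv e h) (dotv e e) (dotv h h) (fine (l u)) (fine (l zp)) (dotv g zp) =>
  a c q p lu' lz' gz.
move: (2 * s)^-1 => k k0 H.
have : t * (- a + lz' - lu' - k * (2 * c)) <= t * (k * q * t) by nra.
rewrite ler_pM2l //= => {}H; lra.
Qed.

(** Each minimizer is tested against the other in the three-point inequality. In the sum the terms
    in [g] and [l] cancel, and [|z1 - z2|^2 <= 0] remains. *)
Lemma prox_unique (s : R) z g z1 z2 u : 0 < s -> (l u < +oo)%E ->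
  is_argmin (prox_objective l s z g) z1 ->
  is_argmin (prox_objective l s z g) z2 -> z1 = z2.
Proof.
move=> s0 lu a1 a2.
have := prox_three_points s0 a1 (argmin_prox_dom a2 lu).
have := prox_three_points s0 a2 (argmin_prox_dom a1 lu).
have -> : z - z1 = (z - z2) - (z1 - z2) by rewrite opprB addrA subrK.
have -> : z1 - z = (z1 - z2) - (z - z2) by rewrite opprB addrA subrK.
have -> : z2 - z1 = - (z1 - z2) by rewrite opprB.
have -> : z2 - z = - (z - z2) by rewrite opprB.
move E : (z1 - z2) => e; move: (z - z2) => h.
rewrite !dotvE (dotvC h e) => H1 H2.
have k0 : 0 < (2 * s)^-1 by rewrite invr_gt0 mulr_gt0.
have e0 : dotv e e <= 0.
  have := lerD H1 H2; move: k0; move: (2 * s)^-1 => k k0; nra.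
by apply/eqP; rewrite -subr_eq0 E (dotvv_le0 e0).
Qed.

End Prox.
End Vectors.

(** * Expectations over finite histories of draws *)

Lemma indic_mul (R : realType) (T : Type) (A B : set T) (o : T) :
  \1_A o * \1_B o = \1_(A `&` B) o :> R.
Proof. by rewrite indicI. Qed.

Section Draws.
Context {R : realType} {disp : measure_display} {T : measurableType disp}.
Variables (P : probability T R) (n : nat).
Variables (J : nat -> T -> {set 'I_n}) (coin : nat -> T -> bool).
Hypothesis indep : mutually_independent P
    [set i | (1 <= match i with inl t => t | inr t => t end)%N] (draws J coin).

(** Iterations are numbered from 1 and ordinals from 0, hence the shift. *)
Definition hist (t : nat) (o : T) : {ffun 'I_t -> {set 'I_n} * bool} :=
  [ffun s : 'I_t => (J s.+1 o, coin s.+1 o)].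

(** Plays the part of measurability with respect to the first [t] rounds of draws; as a history
    takes finitely many values, constancy on its level sets suffices. *)
Definition determined (U : Type) (t : nat) (phi : T -> U) :=
  forall o o', hist t o = hist t o' -> phi o = phi o'.

Lemma histP t o o' : hist t o = hist t o' <->
  forall s, (1 <= s <= t)%N -> J s o = J s o' /\ coin s o = coin s o'.
Proof.
split=> [/ffunP e [//|s] st|e].
  by have := e (Ordinal st); rewrite !ffunE => -[].
by apply/ffunP => s; rewrite !ffunE; have [-> ->] := e s.+1 (ltn_ord s).
Qed.

Lemma hist_le s t o o' : (s <= t)%N -> hist t o = hist t o' -> hist s o = hist s o'.
Proof.
move=> st /histP e; apply/histP => r /andP[r1 rs]; apply: e.
by rewrite r1 (leq_trans rs).
Qed.

Definition draw_index (i : nat + nat) := match i with inl t => t | inr t => t end.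

Definition same_draw (o : T) (i : nat + nat) : set T :=
  match i with
  | inl s => J s @^-1` [set J s o]
  | inr s => coin s @^-1` [set coin s o]
  end.

Definition draws_upto (t : nat) : {fset (nat + nat)} :=
  [fset i in map inl (iota 1 t) ++ map inr (iota 1 t)]%fset.

Lemma in_draws_upto t i : (i \in draws_upto t) = (1 <= draw_index i <= t)%N.
Proof.
rewrite in_fset /= mem_cat; case: i => s /=; rewrite -[(s <= t)%N]ltnS -add1n -mem_iota.
  by rewrite mem_map => [|? ? []//]; case: mapP => [[]|_]//; rewrite orbF.
by rewrite [X in _ || X]mem_map => [|? ? []//]; case: mapP => [[]|_].
Qed.

Definition cell t o := [set o' | hist t o' = hist t o].

(** Puts a history event in the form to which mutual independence applies: a finite intersection
    with one event per draw. *)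
Lemma cellE t o : cell t o = \bigcap_(i in [set` draws_upto t]) same_draw o i.
Proof.
apply/seteqP; split=> o' /=.
  move=> /histP e [] s /=; rewrite in_draws_upto => /e; rewrite /same_draw /=;
  by case.
move=> e; apply/histP => s st; split.
  by have := e (inl s); rewrite /= in_draws_upto => /(_ st).
by have := e (inr s); rewrite /= in_draws_upto => /(_ st).
Qed.

Lemma same_draw_in o i : draws J coin i (same_draw o i).
Proof. by case: i => s; [exists [set J s o]|exists [set coin s o]]. Qed.

Lemma measurable_draw i A : (1 <= draw_index i)%N -> draws J coin i A -> measurable A.
Proof. by move=> i1; apply: (indep.1 i i1). Qed.

Lemma measurable_cell t o : measurable (cell t o).
Proof.
rewrite cellE; apply: fin_bigcap_measurable => // i.
rewrite /= in_draws_upto => /andP[i1 _].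
exact: measurable_draw (same_draw_in o i).
Qed.

Lemma prob_cell_draw t o i A : draw_index i = t.+1 -> draws J coin i A ->
  P (cell t o `&` A) = (P (cell t o) * P A)%E.
Proof.
move=> it dA.
(* One family serves both products: independence is applied to it over the past draws, and over the
   past draws together with [i]. *)
pose E j := if j == i then A else same_draw o j.
have iN : i \notin draws_upto t by rewrite in_draws_upto it ltnn andbF.
have EN j : j \in draws_upto t -> E j = same_draw o j.
  by rewrite /E; case: eqP => // ->; rewrite (negbTE iN).
have Edraw j : draws J coin j (E j).
  by rewrite /E; case: eqP => [->//|_]; apply: same_draw_in.
have cE : cell t o = \bigcap_(j in [set` draws_upto t]) E j.
  by rewrite cellE; apply: eq_bigcapr => j /= /EN ->.
have cAE : cell t o `&` A = \bigcap_(j in [set` (i |` draws_upto t)%fset]) E j.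
  rewrite cE; apply/seteqP; split=> [x [H1 H2] j /=|x H /=].
    by rewrite in_fset1U => /predU1P[->|jt]; [rewrite /E eqxx|exact: (H1 j jt)].
  split=> [j /= jt|]; first by apply: H => /=; rewrite in_fset1U jt orbT.
  by have := H i; rewrite /= in_fset1U eqxx /E eqxx; apply.
rewrite cAE indep.2 => [| j /= |j _]; last exact: Edraw.
  rewrite big_fsetU1 //= /E eqxx muleC; congr (_ * _)%E.
  rewrite cE indep.2 => [//|j /=|j _]; last exact: Edraw.
  by rewrite in_draws_upto => /andP[].
rewrite in_fset1U => /predU1P[->|]; first by rewrite -/(draw_index i) it.
by rewrite in_draws_upto => /andP[].
Qed.

Variable o0 : T.

Definition atom t (h : {ffun 'I_t -> {set 'I_n} * bool}) := hist t @^-1` [set h].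

(* The value o0 on an empty atom is junk: such an atom has probability 0. *)
Definition rep t (h : {ffun 'I_t -> {set 'I_n} * bool}) : T := xget o0 (atom h).

Lemma atomE t (h : {ffun 'I_t -> {set 'I_n} * bool}) :
  atom h = set0 \/ atom h = cell t (rep h).
Proof.
rewrite /rep; case: xgetP => [x _ hx|H]; last by left; apply/seteqP; split=> // o /H.
by right; rewrite /cell hx.
Qed.

Lemma measurable_atom t (h : {ffun 'I_t -> {set 'I_n} * bool}) : measurable (atom h).
Proof. by have [->|->] := atomE h => //; apply: measurable_cell. Qed.

Lemma rep_hist t o : hist t (rep (hist t o)) = hist t o.
Proof. by rewrite /rep; case: xgetP => [x _ //|/(_ o)]; case. Qed.

(** Equals the integral when [phi] is determined by the first [t] rounds. Being a finite sum, it is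
    linear and monotone with no integrability condition. *)
Definition Ex t (phi : T -> R) : R :=
  \sum_h fine (P (@atom t h)) * phi (rep h).

Lemma determined_sum t (phi : T -> R) o : determined t phi ->
  phi o = \sum_(h : {ffun 'I_t -> {set 'I_n} * bool}) phi (rep h) * \1_(atom h) o.
Proof.
move=> dphi; rewrite (bigD1 (hist t o)) //= big1 => [|h ho].
  by rewrite indicE mem_set //= mulr1 addr0; apply: dphi; rewrite rep_hist.
by rewrite indicE memNset ?mulr0 //= => ho'; rewrite -ho' eqxx in ho.
Qed.

Lemma integral_determined_indic t (phi : T -> R) A : determined t phi -> measurable A ->
  (\int[P]_o (phi o * \1_A o)%:E)%E =
  (\sum_(h : {ffun 'I_t -> {set 'I_n} * bool}) phi (rep h) * fine (P (atom h `&` A)))%:E.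
Proof.
move=> dphi mA.
under eq_integral => o _.
  rewrite (determined_sum o dphi) mulr_suml -sumEFin.
  under eq_bigr => h _ do rewrite -mulrA indic_mul EFinM.
  over.
have mB h : measurable (@atom t h `&` A).
  by apply: measurableI => //; apply: measurable_atom.
rewrite integral_sum // => [|h]; last first.
  by apply: integrableZl => //; apply: integrable_indic.
rewrite -sumEFin; apply: eq_bigr => h _; rewrite integralZl //; last exact: integrable_indic.
by rewrite integral_indic // setIT EFinM fineK // fin_num_measure.
Qed.

Lemma integral_Ex t (phi : T -> R) : determined t phi ->
  (\int[P]_o (phi o)%:E)%E = (Ex t phi)%:E.
Proof.
move=> dphi; have := integral_determined_indic dphi measurableT.
under eq_integral do rewrite indicT mulr1.
move=> ->; congr EFin; apply: eq_bigr => h _; by rewrite setIT mulrC.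
Qed.

Lemma Ex_later s t (phi : T -> R) : (s <= t)%N -> determined s phi -> Ex t phi = Ex s phi.
Proof.
move=> st ds; apply: EFin_inj; rewrite -!integral_Ex // => o o' /(hist_le st); exact: ds.
Qed.

Lemma Ex_draw t (phi : T -> R) i A : draw_index i = t.+1 -> draws J coin i A ->
  determined t phi -> (\int[P]_o (phi o * \1_A o)%:E)%E = (fine (P A) * Ex t phi)%:E.
Proof.
move=> it dA dphi.
have mA : measurable A by apply: (measurable_draw _ dA); rewrite it.
rewrite (integral_determined_indic dphi mA) mulr_sumr; congr EFin.
apply: eq_bigr => h _; have [->|hE] := atomE h.
  by rewrite set0I measure0 /= mul0r !mulr0.
rewrite hE (prob_cell_draw _ it dA) fineM ?fin_num_measure //; last exact: measurable_cell.
by rewrite mulrC mulrAC mulrC.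
Qed.

(** Conditioning on the past: a draw of round [t + 1] is independent of the first [t] rounds, so it
    can be averaged over its own law with the history frozen. *)
Lemma Ex_next (V : finType) (X : T -> V) i t (psi : T -> V -> R) :
  draw_index i = t.+1 -> draws J coin i = generated_by X ->
  (forall v, determined t (psi ^~ v)) ->
  determined t.+1 X ->
  Ex t.+1 (fun o => psi o (X o)) =
  Ex t (fun o => \sum_v fine (P (X @^-1` [set v])) * psi o v).
Proof.
move=> it dX dpsi dX'; apply: EFin_inj; rewrite -!integral_Ex; last first.
- by move=> o o' e; rewrite (dX' _ _ e); apply: dpsi; apply: hist_le e.
- by move=> o o' e; apply: eq_bigr => v _; rewrite (dpsi v _ _ e).
have mX v : measurable (X @^-1` [set v]).
  by apply: (@measurable_draw i); [rewrite it|rewrite dX; exists [set v]].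
have -> : (\int[P]_o (psi o (X o))%:E)%E =
  (\int[P]_o \sum_v (psi o v * \1_(X @^-1` [set v]) o)%:E)%E.
  apply: eq_integral => o _; rewrite sumEFin (bigD1 (X o)) //= big1 ?addr0 => [|v vX].
    by rewrite indicE mem_set //= mulr1.
  by rewrite indicE memNset ?mulr0 //= => vX'; rewrite vX' eqxx in vX.
under [RHS]eq_integral do rewrite -sumEFin.
have int1 v A : measurable A -> P.-integrable setT (fun o => (psi o v * \1_A o)%:E).
  move=> mA.
  have -> : (fun o => (psi o v * \1_A o)%:E) =
    (fun o => \sum_(h : {ffun 'I_t -> {set 'I_n} * bool})
      ((psi (rep h) v)%:E * (\1_(atom h `&` A) o)%:E)%E)%E.
    apply/funext => o; rewrite (determined_sum o (dpsi v)) mulr_suml -sumEFin.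
    by apply: eq_bigr => h _; rewrite -mulrA indic_mul EFinM.
  apply: integrable_sum => //= h _; apply: integrableZl => //; apply: integrable_indic.
  by apply: measurableI => //; apply: measurable_atom.
rewrite integral_sum //; last by move=> v; apply: int1.
rewrite integral_sum // => [|v]; last first.
  under eq_fun do rewrite EFinM; apply: integrableZl => //.
  by have := int1 v setT measurableT; under eq_fun do rewrite indicT mulr1.
apply: eq_bigr => v _; rewrite (Ex_draw it) //; last by rewrite dX; exists [set v].
under eq_integral do rewrite EFinM.
rewrite integralZl // ?(integral_Ex (dpsi v)) //.
by have := int1 v setT measurableT; under eq_fun do rewrite indicT mulr1.
Qed.

Lemma ExD t phi psi : Ex t (fun o => phi o + psi o) = Ex t phi + Ex t psi.
Proof. by rewrite -big_split; apply: eq_bigr => h _; rewrite mulrDr. Qed.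

Lemma ExZ t a phi : Ex t (fun o => a * phi o) = a * Ex t phi.
Proof. by rewrite mulr_sumr; apply: eq_bigr => h _; rewrite mulrCA. Qed.

Lemma Ex_le t phi psi : (forall o, phi o <= psi o) -> Ex t phi <= Ex t psi.
Proof.
by move=> H; apply: ler_sum => h _; rewrite ler_wpM2l // fine_ge0.
Qed.

Lemma Ex_ge0 t phi : (forall o, 0 <= phi o) -> 0 <= Ex t phi.
Proof. by move=> H; apply: sumr_ge0 => h _; rewrite mulr_ge0 // fine_ge0. Qed.

Lemma Ex_le0 t phi : (forall o, phi o <= 0) -> Ex t phi <= 0.
Proof. by move=> H; apply: sumr_le0 => h _; rewrite mulr_ge0_le0 // fine_ge0. Qed.

Lemma Ex_sum t (I : Type) (r : seq I) (F : I -> T -> R) :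
  Ex t (fun o => \sum_(i <- r) F i o) = \sum_(i <- r) Ex t (F i).
Proof. by rewrite exchange_big; apply: eq_bigr => h _; rewrite mulr_sumr. Qed.

Lemma Ex_cst t a : Ex t (fun=> a) = a.
Proof.
apply: EFin_inj; rewrite -(@integral_Ex t (fun=> a)) // integral_cst //= probability_setT.
by rewrite mule1.
Qed.

Lemma determined_batch t : determined t.+1 (J t.+1).
Proof. by move=> o o' /histP/(_ t.+1); rewrite /= leqnn => /(_ isT)[]. Qed.

Lemma determined_coin t : determined t.+1 (coin t.+1).
Proof. by move=> o o' /histP/(_ t.+1); rewrite /= leqnn => /(_ isT)[]. Qed.

End Draws.

(** * Sampling a batch without replacement *)

Lemma subset_setC1 (T : finType) (A : {set T}) (i : T) :
  (A \subset ~: finset.set1 i) = (i \notin A).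
Proof. by rewrite finset.subsetC finset.sub1set finset.in_setC. Qed.

Section UniformBatch.
Context {R : realType} (n b : nat).
Hypothesis bn : (1 <= b <= n)%N.

Definition batch_mean (psi : {set 'I_n} -> R) : R :=
  'C(n, b)%:R^-1 * \sum_(A : {set 'I_n} | #|A| == b) psi A.

Lemma batch_meanD f g :
  batch_mean (fun A => f A + g A) = batch_mean f + batch_mean g.
Proof. by rewrite /batch_mean big_split mulrDr. Qed.

Lemma batch_meanZ a f : batch_mean (fun A => a * f A) = a * batch_mean f.
Proof. by rewrite /batch_mean -mulr_sumr mulrCA. Qed.

Lemma batch_mean_sum (I : finType) (F : I -> {set 'I_n} -> R) :
  batch_mean (fun A => \sum_i F i A) = \sum_i batch_mean (F i).
Proof. by rewrite /batch_mean exchange_big -mulr_sumr. Qed.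

Lemma eq_batch_mean f g : f =1 g -> batch_mean f = batch_mean g.
Proof. by move=> e; rewrite /batch_mean; under eq_bigr do rewrite e. Qed.

Lemma binbn_neq0 : 'C(n, b)%:R != 0 :> R.
Proof. by case/andP: bn => _ bn'; rewrite pnatr_eq0 -lt0n bin_gt0. Qed.

Lemma n_neq0 : n%:R != 0 :> R.
Proof. by case/andP: bn => b1 /(leq_trans b1) n0; rewrite pnatr_eq0 -lt0n. Qed.

Lemma b_neq0 : b%:R != 0 :> R.
Proof. by case/andP: bn => b1 _; rewrite pnatr_eq0 -lt0n. Qed.

Lemma batch_mean_cst a : batch_mean (fun=> a) = a.
Proof.
rewrite /batch_mean sumr_const (_ : #|_| = 'C(n, b)); last first.
  rewrite -[X in 'C(X, _)]card_ord -cardsT -cards_draws cardE cardE; congr size.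
  by apply: eq_enum => A; rewrite !inE finset.subsetT.
by rewrite -[a *+ _]mulr_natl mulKf // binbn_neq0.
Qed.

Lemma batch_mean_disjoint (B : {set 'I_n}) :
  batch_mean (fun A => (A \subset ~: B)%:R) = 'C(n - #|B|, b)%:R / 'C(n, b)%:R.
Proof.
rewrite /batch_mean mulrC; congr (_ / _).
rewrite -natr_sum; congr (_ %:R).
rewrite -[X in (X - _)%N]card_ord -(cardsC B) addKn -cards_draws -sum1_card.
rewrite [RHS]big_mkcond [LHS]big_mkcond; apply: eq_bigr => A _.
rewrite !inE; by case: (#|A| == b); case: (A \subset _).
Qed.

(** Complement of the event that the batch misses [i], whose probability is a quotient of
    binomials. *)
Lemma batch_mean_in i : batch_mean (fun A => (i \in A)%:R) = b%:R / n%:R.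
Proof.
have : batch_mean (fun A => (i \in A)%:R + (A \subset ~: finset.set1 i)%:R) = 1.
  rewrite -[RHS](batch_mean_cst 1); apply: eq_batch_mean => A.
  by rewrite subset_setC1; case: (i \in A); rewrite ?addr0 ?add0r.
rewrite batch_meanD batch_mean_disjoint cards1 subn1 => /eqP.
rewrite eq_sym -subr_eq => /eqP <-.
have := mul_bin_down n b => /(congr1 (fun k => k%:R : R)).
case/andP: bn => _ bn'; rewrite !natrM (natrB _ bn') => H.
have H2 : 'C(n.-1, b)%:R = (n%:R - b%:R) * 'C(n, b)%:R / n%:R :> R.
  by rewrite -H mulrC mulKf // n_neq0.
by rewrite H2; field; rewrite n_neq0 binbn_neq0.
Qed.

Definition pair_prob : R := b%:R * (b%:R - 1) / (n%:R * (n%:R - 1)).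

(** Inclusion-exclusion from the probability that the batch misses both indices. *)
Lemma batch_mean_in2 i j : i != j ->
  batch_mean (fun A => (i \in A)%:R * (j \in A)%:R) = pair_prob.
Proof.
move=> ij.
have n2 : (2 <= n)%N.
  by rewrite -[n]card_ord; have := max_card (mem (i |: finset.set1 j)); rewrite cards2 ij.
have n1 : n%:R - 1 != 0 :> R by rewrite subr_eq0 (eqr_nat _ n 1); case: n n2 => [|[]].
have : batch_mean (fun A => (i \in A)%:R * (j \in A)%:R + (1 + - 1 * ((i \in A)%:R + (j \in A)%:R)))
  = batch_mean (fun A => (A \subset ~: (i |: finset.set1 j))%:R).
  apply: eq_batch_mean => A; rewrite finset.setCU finset.subsetI !subset_setC1.
  by case: (i \in A); case: (j \in A) => /=; ring.
rewrite batch_meanD batch_meanD batch_meanZ batch_meanD !batch_mean_in batch_mean_cst.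
rewrite batch_mean_disjoint cards2 ij /= => H0.
have := mul_bin_down n b => /(congr1 (fun k => k%:R : R)).
have := mul_bin_down n.-1 b => /(congr1 (fun k => k%:R : R)).
case/andP: bn => b1 bn'; rewrite !natrM (natrB _ bn').
have -> : (n.-2 = n - 2)%N by case: n n2 => [|[|m]] //; rewrite subn2.
have -> : (n.-1)%:R = n%:R - 1 :> R by rewrite -subn1 natrB // ltnW.
(* Truncated and real subtraction differ only for [b = n], where the binomial vanishes. *)
have H1 : 'C(n.-1, b)%:R * (n.-1 - b)%:R = 'C(n.-1, b)%:R * (n%:R - 1 - b%:R) :> R.
  have [bn1|] := leqP b n.-1; last by move=> h; rewrite bin_small // !mul0r.
  by rewrite natrB // -subn1 natrB // ltnW.
rewrite [X in _ = X -> _]mulrC H1 => H2 H3.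
have E1 : 'C(n.-1, b)%:R = (n%:R - b%:R) * 'C(n, b)%:R / n%:R :> R.
  by rewrite -H3 mulrC mulKf // n_neq0.
have E2 : 'C(n - 2, b)%:R = 'C(n.-1, b)%:R * (n%:R - 1 - b%:R) / (n%:R - 1) :> R.
  by rewrite -H2 mulrC mulKf.
rewrite E2 E1 in H0; rewrite /pair_prob.
suff : batch_mean (fun A => (i \in A)%:R * (j \in A)%:R) =
  (n%:R - b%:R) * 'C(n, b)%:R / n%:R * (n%:R - 1 - b%:R) / (n%:R - 1) / 'C(n, b)%:R
  - 1 + 2 * b%:R / n%:R.
  by move=> ->; field; rewrite n1 n_neq0 binbn_neq0.
by rewrite -H0; ring.
Qed.

Definition batch_error (v : 'I_n -> R) (A : {set 'I_n}) : R :=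
  n%:R^-1 * \sum_i v i - b%:R^-1 * \sum_(i in A) v i.

Lemma batch_mean_partial_sum v :
  batch_mean (fun A => \sum_(i in A) v i) = b%:R / n%:R * \sum_i v i.
Proof.
rewrite (@eq_batch_mean _ (fun A => \sum_i v i * (i \in A)%:R)) => [|A].
  rewrite batch_mean_sum mulr_sumr; apply: eq_bigr => i _.
  by rewrite batch_meanZ batch_mean_in mulrC.
by rewrite big_mkcond; apply: eq_bigr => i _; case: (i \in A); rewrite ?mulr1 ?mulr0.
Qed.

Lemma batch_mean_error v : batch_mean (batch_error v) = 0.
Proof.
rewrite (@eq_batch_mean _ (fun A => n%:R^-1 * \sum_i v i + - b%:R^-1 * \sum_(i in A) v i)).
  rewrite batch_meanD !batch_meanZ batch_mean_partial_sum batch_mean_cst.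
  by field; rewrite n_neq0 b_neq0.
by move=> A; rewrite /batch_error mulNr.
Qed.

Lemma pair_prob_ge0 : 0 <= pair_prob.
Proof.
have [b1 bn'] := andP bn.
by rewrite divr_ge0 // mulr_ge0 ?ler0n // subr_ge0 ler1n // (leq_trans b1).
Qed.

Lemma pair_prob_le : pair_prob <= (b%:R / n%:R) ^+ 2.
Proof.
have [b1 bn'] := andP bn; rewrite /pair_prob.
have b1R : 1 <= b%:R :> R by rewrite ler1n.
(* For [n = 1] the denominator is 0, so the quotient is 0 by convention. *)
have [n1|n1] := eqVneq n 1%N.
  by rewrite n1 subrr mulr0 invr0 mulr0 sqr_ge0.
have n2 : 1 < n%:R :> R.
  by rewrite ltr1n ltn_neqAle eq_sym n1 (leq_trans b1).
have bnR : b%:R <= n%:R :> R by rewrite ler_nat.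
have n0 : 0 < n%:R :> R by lra.
rewrite ler_pdivrMr; last by rewrite mulr_gt0 // subr_gt0.
have -> : (b%:R / n%:R) ^+ 2 * (n%:R * (n%:R - 1)) = b%:R * (b%:R * (n%:R - 1)) / n%:R :> R.
  by field; apply: lt0r_neq0.
rewrite ler_pdivlMr // -mulrA ler_pM2l ?(lt_le_trans ltr01) //.
lra.
Qed.

(* Sampling without replacement has smaller variance than sampling with
   replacement, since the pair probability is at most (b / n)^2. *)
Lemma batch_mean_error_sqr v :
  batch_mean (fun A => batch_error v A ^+ 2) <= (b%:R * n%:R)^-1 * \sum_i v i ^+ 2.
Proof.
have [b1 bn'] := andP bn.
have b0 : 0 < b%:R :> R by rewrite ltr0n.
have n0 : 0 < n%:R :> R by rewrite ltr0n (leq_trans b1).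
set s := \sum_i v i; set q := \sum_i v i ^+ 2.
(* The square is a double sum over indices: diagonal pairs have probability [b / n], the others
   [pair_prob]. *)
have E : batch_mean (fun A => (\sum_(i in A) v i) ^+ 2) =
    pair_prob * s ^+ 2 + (b%:R / n%:R - pair_prob) * q.
  rewrite (@eq_batch_mean _ (fun A =>
      \sum_i \sum_j v i * v j * ((i \in A)%:R * (j \in A)%:R))); last first.
    move=> A; rewrite expr2 mulr_suml big_mkcond; apply: eq_bigr => i _.
    case: (i \in A); last by rewrite big1 // => j _; rewrite mul0r mulr0.
    rewrite mulr_sumr big_mkcond; apply: eq_bigr => j _.
    by case: (j \in A); rewrite mul1r ?mulr1 ?mulr0.
  have row i : batch_mean (fun A => \sum_j v i * v j * ((i \in A)%:R * (j \in A)%:R)) =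
      pair_prob * (v i * s) + (b%:R / n%:R - pair_prob) * v i ^+ 2.
    rewrite batch_mean_sum (bigD1 i) //= batch_meanZ.
    rewrite (@eq_batch_mean _ (fun A => (i \in A)%:R)) => [|A]; last first.
      by case: (i \in A); rewrite ?mul1r ?mul0r.
    rewrite batch_mean_in (_ : s = v i + \sum_(j | j != i) v j); last by rewrite /s (bigD1 i).
    rewrite (eq_bigr (fun j => pair_prob * v i * v j)) => [|j ji]; last first.
      by rewrite batch_meanZ batch_mean_in2 1?eq_sym //; ring.
    by rewrite -mulr_sumr; ring.
  rewrite batch_mean_sum (eq_bigr _ (fun i _ => row i)) big_split /= -!mulr_sumr.
  by rewrite -mulr_suml -expr2.
rewrite (@eq_batch_mean _ (fun A => (n%:R^-1 * s) ^+ 2 +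
    ((- 2 * (n%:R^-1 * s) * b%:R^-1) * (\sum_(i in A) v i) +
     b%:R^-1 ^+ 2 * (\sum_(i in A) v i) ^+ 2))); last first.
  by move=> A; rewrite /batch_error -/s; ring.
rewrite !batch_meanD !batch_meanZ batch_mean_cst E batch_mean_partial_sum -/s.
have q0 : 0 <= q by apply: sumr_ge0 => i _; rewrite sqr_ge0.
have -> : (b%:R * n%:R)^-1 * q = b%:R^-1 ^+ 2 * (b%:R / n%:R * q).
  by field; rewrite !lt0r_neq0.
have -> : (n%:R^-1 * s) ^+ 2 + (- 2 * (n%:R^-1 * s) * b%:R^-1 * (b%:R / n%:R * s)
   + b%:R^-1 ^+ 2 * (pair_prob * s ^+ 2 + (b%:R / n%:R - pair_prob) * q)) =
  b%:R^-1 ^+ 2 * (b%:R / n%:R * q + (pair_prob - (b%:R / n%:R) ^+ 2) * s ^+ 2 - pair_prob * q).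
  by field; rewrite !lt0r_neq0.
rewrite ler_wpM2l ?sqr_ge0 //.
have := pair_prob_le; have := pair_prob_ge0; have := sqr_ge0 s.
move: (s ^+ 2) (pair_prob) (b%:R / n%:R) => S p pi S0 p0 pl.
have : (p - pi ^+ 2) * S <= 0 by rewrite mulr_le0_ge0 // subr_le0.
have : 0 <= p * q by rewrite mulr_ge0.
lra.
Qed.

End UniformBatch.

(** * One iteration *)

Section Average.
Context {R : realType} {n d : nat}.
Variables (f : 'I_n -> 'rV[R]_d -> R) (L : R).
Hypotheses (n0 : (0 < n)%N) (L0 : 0 < L).
Hypothesis fdiff : forall i x, differentiable (f i) x.
Hypothesis fsm : forall i, smooth_with L (f i).
Hypothesis fcv : forall i, convex_function [set: convex_lmodType 'rV[R]_d] (f i).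
Implicit Types u v w x : 'rV[R]_d.

Lemma grad_favg x : grad (favg f) x = n%:R^-1 *: \sum_i grad (f i) x.
Proof.
apply/rowP => j; rewrite !mxE summxE.
have -> : favg f = n%:R^-1 \*: (\sum_i f i).
  by apply/funext => y; rewrite /favg /= fct_sumE.
have df i : derivable (f i) x (delta_mx 0 j) by apply: diff_derivable.
rewrite deriveZ; last exact: derivable_sum.
by rewrite derive_sum //; congr (_ * _); apply: eq_bigr => i _; rewrite mxE.
Qed.

Let nV : n%:R^-1 * n%:R = 1 :> R.
Proof. by rewrite mulVf // pnatr_eq0 -lt0n. Qed.

Let nV0 : 0 <= n%:R^-1 :> R. Proof. by rewrite invr_ge0. Qed.

Lemma average_cst (a : R) : a = n%:R^-1 * \sum_(i < n) a.
Proof. by rewrite sumr_const card_ord -[a *+ _]mulr_natl mulrA nV mul1r. Qed.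

Lemma dotv_grad_favg x v :
  dotv (grad (favg f) x) v = n%:R^-1 * \sum_i dotv (grad (f i) x) v.
Proof. by rewrite grad_favg dotvZl dotv_suml. Qed.

Lemma favg_smooth : smooth_with L (favg f).
Proof.
move=> u v; rewrite dotv_grad_favg [L / 2 * _]average_cst -!mulrDr -!big_split.
by rewrite ler_wpM2l // ler_sum // => i _; apply: fsm.
Qed.

Lemma favg_first_order u x : favg f x + dotv (grad (favg f) x) (u - x) <= favg f u.
Proof.
rewrite dotv_grad_favg -!mulrDr -!big_split.
rewrite ler_wpM2l // ler_sum // => i _.
exact: (convex_first_order (fsm i) (fcv i)).
Qed.

Lemma favg_cocoercive w x :
  n%:R^-1 * \sum_i dotv (grad (f i) x - grad (f i) w) (grad (f i) x - grad (f i) w) <=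
  2 * L * (favg f w - favg f x - dotv (grad (favg f) x) (w - x)).
Proof.
rewrite dotv_grad_favg /favg -!mulrBr -!sumrB mulrCA ler_wpM2l // mulr_sumr.
by apply: ler_sum => i _; apply: (cocoercive L0 (fsm i) (fcv i)).
Qed.

(** The full gradient at [w] cancels, so each coordinate of the gradient noise is a scalar sampling
    error and the scalar moments apply. *)
Lemma batch_error_grad b A x w (k : 'I_d) :
  (grad (favg f) x - grad_estimate f b A x w) 0 k =
  batch_error b (fun i => (grad (f i) x - grad (f i) w) 0 k) A.
Proof.
rewrite /grad_estimate /batch_error !grad_favg !(mxE, summxE).
have -> : \sum_i (grad (f i) x - grad (f i) w) 0 k =
  \sum_i (grad (f i) x) 0 k - \sum_i (grad (f i) w) 0 k.
  by rewrite -sumrB; apply: eq_bigr => i _; rewrite !mxE.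
ring.
Qed.

Lemma batch_mean_gradient_noise b x w u : (1 <= b <= n)%N ->
  batch_mean b (fun A => dotv (grad (favg f) x - grad_estimate f b A x w) u) = 0.
Proof.
move=> bn; pose V k i := (grad (f i) x - grad (f i) w) 0 k.
rewrite (@eq_batch_mean _ _ _ _ (fun A => \sum_k u 0 k * batch_error b (V k) A)) => [|A].
  by rewrite batch_mean_sum big1 // => k _; rewrite batch_meanZ batch_mean_error // mulr0.
by apply: eq_bigr => k _; rewrite batch_error_grad mulrC.
Qed.

(** The sampling variance is summed over coordinates, and cocoercivity turns the squared gradient
    differences into a Bregman distance. *)
Lemma batch_mean_gradient_variance b x w : (1 <= b <= n)%N ->
  batch_mean b (fun A => dotv (grad (favg f) x - grad_estimate f b A x w)
                              (grad (favg f) x - grad_estimate f b A x w)) <=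
  2 * L / b%:R * (favg f w - favg f x - dotv (grad (favg f) x) (w - x)).
Proof.
move=> bn; pose V k i := (grad (f i) x - grad (f i) w) 0 k.
rewrite (@eq_batch_mean _ _ _ _ (fun A => \sum_k batch_error b (V k) A ^+ 2)) => [|A]; last first.
  by apply: eq_bigr => k _; rewrite batch_error_grad expr2.
rewrite batch_mean_sum.
apply: (@le_trans _ _ (\sum_k (b%:R * n%:R)^-1 * \sum_i V k i ^+ 2)).
  by apply: ler_sum => k _; apply: batch_mean_error_sqr.
rewrite -mulr_sumr exchange_big /= invfM.
rewrite [2 * L / _]mulrC -[in leRHS]mulrA -[in leLHS]mulrA.
apply: ler_wpM2l; first by rewrite invr_ge0.
apply: le_trans (favg_cocoercive w x).
by rewrite ler_wpM2l // ler_sum // => i _; rewrite ler_sum // => k _; rewrite expr2.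
Qed.

End Average.

(** * The one-step inequality and its average over the batch *)

Section OneStep.
Context {R : realType} {n d : nat}.
Variables (f : 'I_n -> 'rV[R]_d -> R) (l : 'rV[R]_d -> \bar R) (L : R) (xs : 'rV[R]_d).
Hypotheses (n0 : (0 < n)%N) (L0 : 0 < L) (pa : problem_assumptions f l L xs).
Hypothesis lxs : (l xs < +oo)%E.
Implicit Types u v w x y z g : 'rV[R]_d.

Definition gap_at u : R := favg f u + fine (l u) - (favg f xs + fine (l xs)).

(** Deterministic, for an arbitrary vector [g] in place of the gradient; the last bracket collects
    the terms in the error and the Bregman term at [w], to be averaged later. *)
Lemma one_step (a xi' c eta : R) x y z w zp yp g :
  0 < a -> 0 <= xi' -> a^-1 + xi' < 1 -> 0 < c -> 0 < eta -> eta <= (c * L + L)^-1 ->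
  x = a^-1 *: z + xi' *: w + (1 - xi' - a^-1) *: y ->
  is_argmin (prox_objective l (a * eta) z g) zp ->
  yp = x + a^-1 *: (zp - z) ->
  (l w < +oo)%E -> (l y < +oo)%E ->
  [/\ (l zp < +oo)%E, (l yp < +oo)%E &
    a ^+ 2 * gap_at yp + (2 * eta)^-1 * dotv (zp - xs) (zp - xs) <=
    (a ^+ 2 - xi' * a ^+ 2 - a) * gap_at y + xi' * a ^+ 2 * gap_at w
    + (2 * eta)^-1 * dotv (z - xs) (z - xs) +
    (xi' * a ^+ 2 * (favg f x + dotv (grad (favg f) x) (w - x) - favg f w) +
     a ^+ 2 * (2 * (c * L))^-1 * dotv (grad (favg f) x - g) (grad (favg f) x - g) +
     a * dotv (grad (favg f) x - g) (z - xs))].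
Proof.
move=> a0 xi0 axi c0 eta0 etaL xE am ypE lw ly.
have lz := argmin_prox_dom (l_proper pa) am lxs.
set t := a^-1 in axi xE ypE.
have t0 : 0 < t by rewrite invr_gt0.
(* The same convex combination as [x], with [zp] in place of [z]; Jensen's inequality for [l] then
   applies at [yp]. *)
have ypE' : yp = t *: zp + xi' *: w + (1 - xi' - t) *: y.
  by rewrite ypE xE; apply/rowP => j; rewrite !mxE; ring.
have [lyp Lc] := convex_fine3 (l_proper pa) (l_convex pa) (ltW t0) xi0 axi lz lw ly.
rewrite -ypE' in lyp Lc; split => //.
have S := favg_smooth n0 (f_differentiable pa) (f_smooth pa) x yp.
have C1 := favg_first_order (f_differentiable pa) (f_smooth pa) (f_convex pa) xs x.
have C2 := favg_first_order (f_differentiable pa) (f_smooth pa) (f_convex pa) y x.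
have Pr := prox_three_points (l_proper pa) (l_convex pa) (mulr_gt0 a0 eta0) am lxs.
set G := grad (favg f) x in S C1 C2 *.
pose e := G - g.
have cL : 0 < c * L by rewrite mulr_gt0.
(* The weight [c * L] is chosen so that this term and the smoothness term total [(c L + L) / 2]
   times [|yp - x|^2], which the proximal step absorbs as [eta <= 1 / (c L + L)]. *)
have Y := dotv_young e (t *: (zp - z)) cL.
(* The weighted displacements from [x] sum to zero by the definition of [x]. *)
have X : t * dotv G (z - x) + xi' * dotv G (w - x) + (1 - xi' - t) * dotv G (y - x) = 0.
  rewrite -!dotvZr -!dotvDr [X in dotv _ X](_ : _ = 0); last first.
    by rewrite [in LHS]xE; apply/rowP => j; rewrite !mxE; ring.
  by rewrite -(scale0r 0) dotvZr mul0r.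
have ypx : yp - x = t *: (zp - z) by rewrite ypE addrC addKr.
rewrite enorm_sqr ypx in S.
have E1 : dotv G (t *: (zp - z)) =
   t * dotv g (zp - xs) + t * dotv G (xs - x) - t * dotv G (z - x)
   + t * dotv e (z - xs) + dotv e (t *: (zp - z)).
  by rewrite /e !dotvE; ring.
rewrite E1 in S.
have eta1 : c * L + L <= eta^-1.
  by rewrite -[c * L + L]invrK lef_pV2 // posrE ?invr_gt0 ?addr_gt0.
move: S C1 C2 Pr Y X; rewrite -/e !dotvZl !dotvZr /gap_at.
have -> : (2 * (a * eta))^-1 = t * eta^-1 / 2 by rewrite /t; field; rewrite !lt0r_neq0.
have -> : (2 * eta)^-1 = eta^-1 / 2 by field; rewrite lt0r_neq0.
have at1 : a * t = 1 by rewrite mulfV // lt0r_neq0.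
clearbody t; move: (dotvv_ge0 (zp - z)) at1 eta1 Lc.
move: (dotv (zp - z) (zp - z)) (dotv (zp - xs) (zp - xs)) (dotv (z - xs) (z - xs)) (dotv e e) =>
  q q1 q2 q3.
move: (dotv e (zp - z)) (dotv e (z - xs)) (dotv G (xs - x)) (dotv G (z - x)) (dotv g (zp - xs))
  (dotv G (y - x)) (dotv G (w - x)) => e1 e2 g1 g2 g3 g4 g5.
move: (favg f x) (favg f xs) (favg f y) (favg f w) (favg f yp) => fx fs fy fw fp.
move: (fine (l zp)) (fine (l xs)) (fine (l w)) (fine (l y)) (fine (l yp)) => lz' ls' lw' ly' lp'.
move: (eta^-1) => ie; move: (2 * (c * L))^-1 => k q0 at1 eta1 Lc S C1 C2 Pr Y X.
have T1 : t * (g3 + lz' - ls') <= t * (t * ie / 2 * (q2 - q1 - q)) by rewrite ler_pM2l.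
have T2 : t * (fx + g1) <= t * fs by rewrite ler_pM2l.
have T3 : (1 - xi' - t) * (fx + g4) <= (1 - xi' - t) * fy by rewrite ler_pM2l //; lra.
have T4 : t * (t * q) * (c * L + L) <= t * (t * q) * ie.
  by rewrite ler_wpM2l // !mulr_ge0 // ltW.
(* The inequality divided by [a^2]. First-order convexity is applied at [xs] and [y]; at [w] its
   slack is kept, to pay for the variance. *)
have M : fp + lp' - (fs + ls') <=
   (1 - xi' - t) * (fy + ly' - (fs + ls')) + xi' * (fw + lw' - (fs + ls'))
   + t * t * (ie / 2) * (q2 - q1) + (xi' * (fx + g5 - fw) + k * q3 + t * e2).
  lra.
have a2 : 0 < a ^+ 2 by rewrite exprn_gt0.
move: M; set rhs := (X in _ <= X) => M.
have {}M : a ^+ 2 * (fp + lp' - (fs + ls')) <= a ^+ 2 * rhs by rewrite ler_pM2l.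
move: M.
have -> : a ^+ 2 * rhs = (a ^+ 2 - xi' * a ^+ 2 - a * (a * t)) * (fy + ly' - (fs + ls'))
   + xi' * a ^+ 2 * (fw + lw' - (fs + ls')) + (a * t) ^+ 2 * (ie / 2) * (q2 - q1)
   + (xi' * a ^+ 2 * (fx + g5 - fw) + a ^+ 2 * k * q3 + a * (a * t) * e2).
  by rewrite /rhs; ring.
rewrite at1 expr1n mulr1; lra.
Qed.

(* The term with weight xi cancels the bound on the variance of the gradient
   estimate. *)
Lemma batch_mean_one_step (a c : R) b x w z :
  (1 <= b <= n)%N -> 0 < c ->
  batch_mean b (fun A =>
    (b%:R * c)^-1 * a ^+ 2 * (favg f x + dotv (grad (favg f) x) (w - x) - favg f w) +
    a ^+ 2 * (2 * (c * L))^-1 *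
      dotv (grad (favg f) x - grad_estimate f b A x w) (grad (favg f) x - grad_estimate f b A x w) +
    a * dotv (grad (favg f) x - grad_estimate f b A x w) (z - xs)) <= 0.
Proof.
move=> bn c0; have b0 : 0 < b%:R :> R by case/andP: bn => ? _; rewrite ltr0n.
rewrite !batch_meanD !batch_meanZ batch_mean_cst //.
rewrite (batch_mean_gradient_noise (f_differentiable pa)) //.
have := batch_mean_gradient_variance L0 (f_differentiable pa) (f_smooth pa) (f_convex pa) x w bn.
set m := batch_mean _ _.
set q := favg f w - _ - _ => H.
have -> : favg f x + dotv (grad (favg f) x) (w - x) - favg f w = - q by rewrite /q; ring.
have k0 : 0 <= a ^+ 2 * (2 * (c * L))^-1.
  by rewrite mulr_ge0 ?sqr_ge0 // invr_ge0 ltW // !mulr_gt0.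
have := ler_wpM2l k0 H.
have -> : a ^+ 2 * (2 * (c * L))^-1 * (2 * L / b%:R * q) = (b%:R * c)^-1 * a ^+ 2 * q.
  by field; rewrite !lt0r_neq0.
lra.
Qed.

End OneStep.

(** * Parameter schedules *)

Section ScheduleBounds.
Context {R : realType}.

Lemma alpha_late t : (16 < t)%N -> alpha t = t%:R / 4 :> R.
Proof. by rewrite /alpha ltnNge => /negbTE ->. Qed.

Lemma alpha_early t : (t <= 16)%N -> alpha t = 6 :> R.
Proof. by rewrite /alpha => ->. Qed.

Lemma alpha_ge t : 17 / 4 <= alpha t :> R.
Proof.
rewrite /alpha; case: (leqP t 16) => [_|t17]; first lra.
by rewrite ler_pM2r ?invr_gt0 // (ler_nat _ 17).
Qed.

Lemma alpha_gt0 t : 0 < alpha t :> R.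
Proof. by apply: lt_le_trans (alpha_ge t); lra. Qed.

Lemma alpha_sqr_ge t : t%:R ^+ 2 / 16 <= alpha t ^+ 2 :> R.
Proof.
have [t16|t17] := leqP t 16; last by rewrite alpha_late //; lra.
rewrite alpha_early //; have : t%:R <= 16 :> R by rewrite (ler_nat _ _ 16).
have := ler0n R t; nra.
Qed.

Lemma cpar_ge3 b : 3 <= cpar b :> R.
Proof.
rewrite /cpar; have : 2 <= Num.max 2 (b%:R^-1 * Num.max (6 / 5) ((1 - (alpha 17)^-1)^-1)) :> R.
  by rewrite le_max lexx.
lra.
Qed.

Lemma xi_ge0 b : 0 <= xi b :> R.
Proof. by rewrite invr_ge0 mulr_ge0 ?ler0n // (le_trans _ (cpar_ge3 b)). Qed.

Lemma xi_le b : xi b <= (3 * b%:R)^-1 :> R.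
Proof.
case: b => [|b]; first by rewrite /xi mul0r mulr0 invr0.
by rewrite lef_pV2 ?posrE ?mulr_gt0 ?ltr0n // ?(lt_le_trans _ (cpar_ge3 _)) //
  mulrC ler_pM2l ?ltr0n // cpar_ge3.
Qed.

(** The two terms are at most 4/17 and 1/3. Hence the coefficient of [y] in the x-step is
    positive. *)
Lemma inv_alpha_xi_lt1 b t : (1 <= b)%N -> (alpha t)^-1 + xi b < 1 :> R.
Proof.
move=> b1.
have A : (alpha t)^-1 <= (17 / 4)^-1 :> R.
  by rewrite lef_pV2 ?posrE ?alpha_gt0 ?alpha_ge //; lra.
have B : xi b <= 3^-1 :> R.
  apply: le_trans (xi_le b) _; rewrite lef_pV2 ?posrE ?mulr_gt0 ?ltr0n //.
  by rewrite ler_peMr // ler1n.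
apply: le_lt_trans (lerD A B) _; lra.
Qed.

Variables (atil : R).

Definition ckpt_weight (t : nat) : R :=
  atil + alpha 0 ^+ 2 - alpha t ^+ 2 + \sum_(1 <= j < t.+1) alpha j.

Lemma ckpt_weight0 : ckpt_weight 0 = atil.
Proof. by rewrite /ckpt_weight big_geq // addr0 addrK. Qed.

Lemma ckpt_weightS t :
  ckpt_weight t.+1 = ckpt_weight t + (alpha t ^+ 2 - alpha t.+1 ^+ 2 + alpha t.+1).
Proof. by rewrite /ckpt_weight [in LHS]big_nat_recr //=; ring. Qed.

Lemma ckpt_weight_early t : (t <= 16)%N -> ckpt_weight t = atil + 6 * t%:R.
Proof.
elim: t => [|t IH] t16; first by rewrite ckpt_weight0 mulr0 addr0.
by rewrite ckpt_weightS IH ?(ltnW t16) // !alpha_early ?(ltnW t16) // -natr1; ring.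
Qed.

(** From index s to s + 1 the increment is (2 s + 3) / 16; the constant 98 is fixed by the value at
    17, just after the schedule switches. *)
Lemma ckpt_weight_late t :
  ckpt_weight (17 + t) = atil + 98 + (17 + t)%:R ^+ 2 / 16 + (17 + t)%:R / 8.
Proof.
elim: t => [|t IH].
  by rewrite addn0 ckpt_weightS ckpt_weight_early // alpha_early // alpha_late //; lra.
by rewrite addnS ckpt_weightS IH !alpha_late ?ltn_addr // -[(17 + t).+1%:R]natr1; field.
Qed.

Hypothesis atil0 : 0 < atil.

Lemma ckpt_weight_ge t : t%:R ^+ 2 / 16 <= ckpt_weight t.
Proof.
have t0 := ler0n R t.
have [t16|t17] := leqP t 16.
  rewrite ckpt_weight_early //; have : t%:R <= 16 :> R by rewrite (ler_nat _ _ 16).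
  by move: atil0; nra.
rewrite -(subnKC t17) ckpt_weight_late subnKC //; move: atil0; lra.
Qed.

Lemma ckpt_weight_gt0 t : 0 < ckpt_weight t.
Proof.
case: t => [|t]; first by rewrite ckpt_weight0.
by apply: lt_le_trans (ckpt_weight_ge _); rewrite divr_gt0 // exprn_gt0.
Qed.

Lemma ckpt_probE b t :
  ckpt_prob atil b t.+1 * ckpt_weight t.+1 =
  alpha t ^+ 2 - alpha t.+1 ^+ 2 + alpha t.+1 + xi b * alpha t.+1 ^+ 2.
Proof. by rewrite /ckpt_prob divfK // lt0r_neq0 // ckpt_weight_gt0. Qed.

(** From 18 on both [alpha t.-1] and [alpha t] are linear, so apart from its [xi] term the numerator
    is (2 t + 1) / 16, at most 3 t / 16, while the denominator is at least t^2 / 16. *)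
Lemma ckpt_prob_late b t : (18 <= t)%N -> ckpt_prob atil b t <= 3 / t%:R + xi b.
Proof.
case: t => // t t17; rewrite ltnS in t17.
have t0 : 0 < t.+1%:R :> R by rewrite ltr0n.
rewrite -(ler_pM2r (ckpt_weight_gt0 t.+1)) ckpt_probE.
have t1 : (16 < t.+1)%N by rewrite ltnS ltnW.
rewrite !alpha_late //.
have := ckpt_weight_ge t.+1; move: (ckpt_weight t.+1) => q Hq.
have H1 : 3 / t.+1%:R * (t.+1%:R ^+ 2 / 16) <= 3 / t.+1%:R * q.
  by rewrite ler_pM2l // divr_gt0.
have H2 : xi b * (t.+1%:R ^+ 2 / 16) <= xi b * q by rewrite ler_wpM2l // xi_ge0.
have E1 : 3 / t.+1%:R * (t.+1%:R ^+ 2 / 16) = 3 * t.+1%:R / 16 :> R.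
  by field; apply: lt0r_neq0.
rewrite E1 in H1.
have t1' : 1 <= t.+1%:R :> R by rewrite ler1n.
have E2 : t%:R = t.+1%:R - 1 :> R by rewrite -natr1 addrK.
rewrite E2 [leRHS]mulrDl; move: H1 H2 t1'; clear.
move: (3 / t.+1%:R * q) (xi b) (t.+1%:R) => p k s H1 H2 s1; lra.
Qed.

End ScheduleBounds.

(** * Decrease of the expected potential *)

Section Run.
Context {R : realType} {n d b : nat}.
Variables (f : 'I_n -> 'rV[R]_d -> R) (l : 'rV[R]_d -> \bar R).
Variables (xs x1 : 'rV[R]_d) (L eta atil : R).
Context {disp : measure_display} {T : measurableType disp}.
Variables (P : probability T R) (J : nat -> T -> {set 'I_n}) (coin : nat -> T -> bool).
Variables (x y z w : nat -> T -> 'rV[R]_d) (o0 : T).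
Hypotheses (bn : (1 <= b <= n)%N) (L0 : 0 < L) (eta0 : 0 < eta).
Hypothesis etaL : eta <= (cpar b * L + L)^-1.
Hypothesis atil0 : xi b * alpha 1 ^+ 2 <= atil.
Hypothesis pa : problem_assumptions f l L xs.
Hypothesis rd : random_draws P b (ckpt_prob atil b) J coin.
Hypothesis run : algorithm_run f l b eta x1 J coin x y z w.

Local Notation Ex := (Ex P J coin o0).
Local Notation D := (gap_at f l xs).
Local Notation indep := (draws_independent rd).

Lemma atil_gt0 : 0 < atil.
Proof.
have b0 : (0 < b)%N by case/andP: bn.
apply: lt_le_trans atil0; rewrite mulr_gt0 ?exprn_gt0 ?alpha_gt0 //.
by rewrite invr_gt0 mulr_gt0 ?ltr0n // (lt_le_trans _ (cpar_ge3 _)).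
Qed.

Lemma start_dom : (l x1 < +oo)%E.
Proof.
have := start_finite run; rewrite /objective; have := (l_proper pa).1 x1.
by case: (l x1) => [r|//|//] _ _; rewrite ltry.
Qed.

Lemma minimizer_dom : (l xs < +oo)%E.
Proof.
have := le_lt_trans (xstar_minimizer pa x1) (start_finite run); rewrite /objective.
by have := (l_proper pa).1 xs; case: (l xs) => [r|//|//] _ _; rewrite ltry.
Qed.

Lemma objective_gap u : (l u < +oo)%E -> (objective f l u - objective f l xs = (D u)%:E)%E.
Proof.
move=> lu; rewrite /objective (proper_fin (l_proper pa) lu).
by rewrite (proper_fin (l_proper pa) minimizer_dom).
Qed.

Lemma gap_at_ge0 u : (l u < +oo)%E -> 0 <= D u.
Proof.
move=> lu; have := xstar_minimizer pa u; rewrite /objective.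
rewrite (proper_fin (l_proper pa) lu) (proper_fin (l_proper pa) minimizer_dom).
by rewrite -!EFinD lee_fin /gap_at subr_ge0.
Qed.

(** The run specifies [z] only as a minimizer; uniqueness of the proximal point makes it a function
    of the history. *)
Lemma determined_state t : determined J coin t (fun o => (y t.+1 o, z t.+1 o, w t.+1 o)).
Proof.
elim: t => [|t IH] o o' e.
  by have [_ -> -> ->] := start run o; have [_ -> -> ->] := start run o'.
have [ey ez ew] := IH _ _ (hist_le (leqnSn t) e).
have [eJ ec] : J t.+1 o = J t.+1 o' /\ coin t.+1 o = coin t.+1 o'.
  by move/histP: e; apply; rewrite leqnn.
have ex : x t.+2 o = x t.+2 o' by rewrite !(x_step run) // ey ez ew.
have ez' : z t.+2 o = z t.+2 o'.
  have := z_step run o (isT : (1 <= t.+1)%N); rewrite ex ez eJ ew => am.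
  apply: (prox_unique (l_proper pa) (l_convex pa) _ minimizer_dom am).
    by rewrite mulr_gt0 // alpha_gt0.
  exact: (z_step run).
by rewrite !(y_step run) // (w_step run o) // (w_step run o') // ex ez ez' ey ew ec.
Qed.

Definition noise a u z' w' A : R :=
  xi b * a ^+ 2 * (favg f u + dotv (grad (favg f) u) (w' - u) - favg f w') +
  a ^+ 2 * (2 * (cpar b * L))^-1 *
    dotv (grad (favg f) u - grad_estimate f b A u w') (grad (favg f) u - grad_estimate f b A u w') +
  a * dotv (grad (favg f) u - grad_estimate f b A u w') (z' - xs).

Definition predictable_part a (y' z' w' : 'rV[R]_d) : R :=
  (a ^+ 2 - xi b * a ^+ 2 - a) * D y' + xi b * a ^+ 2 * D w' +
  (2 * eta)^-1 * dotv (z' - xs) (z' - xs).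

Lemma run_step t o : (l (y t.+1 o) < +oo)%E -> (l (w t.+1 o) < +oo)%E ->
  [/\ (l (z t.+2 o) < +oo)%E, (l (y t.+2 o) < +oo)%E &
    alpha t.+1 ^+ 2 * D (y t.+2 o) +
      (2 * eta)^-1 * dotv (z t.+2 o - xs) (z t.+2 o - xs) <=
    predictable_part (alpha t.+1) (y t.+1 o) (z t.+1 o) (w t.+1 o) +
    noise (alpha t.+1) (x t.+2 o) (z t.+1 o) (w t.+1 o) (J t.+1 o)].
Proof.
move=> ly lw; have /andP[b1 bn'] := bn.
apply: (one_step (leq_trans b1 bn') L0 pa minimizer_dom) => //.
- exact: alpha_gt0.
- exact: xi_ge0.
- exact: inv_alpha_xi_lt1.
- exact: lt_le_trans (cpar_ge3 b).
- exact: (x_step run).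
- exact: (z_step run).
- exact: (y_step run).
Qed.

Lemma iterates_dom t o : (l (y t.+1 o) < +oo)%E /\ (l (w t.+1 o) < +oo)%E.
Proof.
elim: t => [|t [ly lw]]; first by have [_ -> _ ->] := start run o; split; apply: start_dom.
by have [_ ly' _] := run_step ly lw; split=> //; rewrite (w_step run) //; case: ifP.
Qed.

Lemma prob_batch t (A : {set 'I_n}) : fine (P (J t.+1 @^-1` [set A])) =
  if #|A| == b then 'C(n, b)%:R^-1 else 0.
Proof. by rewrite (batch_uniform rd) //; case: ifP. Qed.

Lemma prob_coin t v : fine (P (coin t.+1 @^-1` [set v])) =
  if v then ckpt_prob atil b t.+1 else 1 - ckpt_prob atil b t.+1.
Proof.
have H : P (coin t.+1 @^-1` [set true]) = (ckpt_prob atil b t.+1)%:E by apply: (coin_law rd).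
case: v; first by rewrite H.
have -> : coin t.+1 @^-1` [set false] = ~` (coin t.+1 @^-1` [set true]).
  by apply/seteqP; split=> o /=; case: (coin t.+1 o).
rewrite probability_setC ?H //; apply: (@measurable_draw _ _ _ P _ J coin indep (inr t.+1)) => //.
by exists [set true].
Qed.

Lemma Ex_coin t (g h : T -> R) : determined J coin t g -> determined J coin t h ->
  Ex t.+1 (fun o => if coin t.+1 o then g o else h o) =
  ckpt_prob atil b t.+1 * Ex t g + (1 - ckpt_prob atil b t.+1) * Ex t h.
Proof.
move=> dg dh; rewrite (@Ex_next _ _ _ _ _ _ _ indep o0 _ (coin t.+1) (inr t.+1) t
  (fun o (v : bool) => if v then g o else h o)) //.
- rewrite -!ExZ -ExD; apply: eq_bigr => h' _.
  by rewrite big_bool !prob_coin.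
- by case.
- exact: determined_coin.
Qed.

(** The batch is independent of the current state, so the noise is averaged over the batch for each
    fixed state. *)
Lemma Ex_noise_le0 t :
  Ex t.+1 (fun o => noise (alpha t.+1) (x t.+2 o) (z t.+1 o) (w t.+1 o) (J t.+1 o)) <= 0.
Proof.
rewrite (@Ex_next _ _ _ _ _ _ _ indep o0 _ (J t.+1) (inl t.+1) t
  (fun o A => noise (alpha t.+1) (x t.+2 o) (z t.+1 o) (w t.+1 o) A)) //.
- apply: Ex_le0 => o.
  have := batch_mean_one_step L0 pa (alpha t.+1) (x t.+2 o) (w t.+1 o) (z t.+1 o) bn
    (lt_le_trans (ltr0n R 3) (cpar_ge3 b)).
  apply: le_trans; rewrite le_eqVlt; apply/orP; left; apply/eqP.
  rewrite /batch_mean mulr_sumr [RHS]big_mkcond; apply: eq_bigr => A _.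
  by rewrite prob_batch; case: ifP => _; rewrite ?mul0r.
- by move=> A o o' e; rewrite !(x_step run) //; have [-> -> ->] := determined_state e.
- exact: determined_batch.
Qed.

(** Index [t] refers to the iterates numbered [t + 1], which the first [t] rounds determine. *)
Definition potential t : R :=
  alpha t ^+ 2 * Ex t (fun o => D (y t.+1 o)) +
  ckpt_weight atil t * Ex t (fun o => D (w t.+1 o)) +
  (2 * eta)^-1 * Ex t (fun o => dotv (z t.+1 o - xs) (z t.+1 o - xs)).

Lemma potential_nonincreasing t : potential t.+1 <= potential t.
Proof.
have Hw : Ex t.+1 (fun o => D (w t.+2 o)) =
    ckpt_prob atil b t.+1 * Ex t (fun o => D (y t.+1 o)) +
    (1 - ckpt_prob atil b t.+1) * Ex t (fun o => D (w t.+1 o)).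
  rewrite -Ex_coin => [|o o' /determined_state[-> _ _]|o o' /determined_state[_ _ ->]] //.
  by apply: eq_bigr => h _; rewrite (w_step run) // (fun_if D).
have Hy : alpha t.+1 ^+ 2 * Ex t.+1 (fun o => D (y t.+2 o)) +
    (2 * eta)^-1 * Ex t.+1 (fun o => dotv (z t.+2 o - xs) (z t.+2 o - xs)) <=
    Ex t (fun o => predictable_part (alpha t.+1) (y t.+1 o) (z t.+1 o) (w t.+1 o)).
  rewrite -!ExZ -ExD.
  apply: (@le_trans _ _ (Ex t.+1 (fun o =>
    predictable_part (alpha t.+1) (y t.+1 o) (z t.+1 o) (w t.+1 o) +
    noise (alpha t.+1) (x t.+2 o) (z t.+1 o) (w t.+1 o) (J t.+1 o)))).
    apply: Ex_le => o; have [ly lw] := iterates_dom t o.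
    by have [_ _ H] := run_step ly lw; exact: H.
  rewrite ExD -[leRHS]addr0; apply: lerD (Ex_noise_le0 t).
  by rewrite (Ex_later indep o0 (leqnSn t)) // => o o' /determined_state[-> -> ->].
have Hpred : Ex t (fun o => predictable_part (alpha t.+1) (y t.+1 o) (z t.+1 o) (w t.+1 o)) =
    (alpha t.+1 ^+ 2 - xi b * alpha t.+1 ^+ 2 - alpha t.+1) * Ex t (fun o => D (y t.+1 o)) +
    xi b * alpha t.+1 ^+ 2 * Ex t (fun o => D (w t.+1 o)) +
    (2 * eta)^-1 * Ex t (fun o => dotv (z t.+1 o - xs) (z t.+1 o - xs)).
  by rewrite -!ExZ -!ExD.
rewrite /potential Hw; move: Hy; rewrite Hpred.
set EY := Ex t.+1 (fun o => D _); set EZ := Ex t.+1 (fun o => dotv _ _).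
have := ckpt_probE atil_gt0 b t; rewrite ckpt_weightS.
set q := ckpt_weight atil t; set p := ckpt_prob _ _ _.
set a' := alpha t.+1; set a := alpha t.
set ey := Ex t (fun o => D (y t.+1 o)); set ew := Ex t (fun o => D (w t.+1 o)).
set ez := Ex t (fun o => dotv _ _).
(* Isolates [p] times the new checkpoint weight. Once its value is substituted, the total
   coefficients of [ey] and [ew] collapse to [a ^+ 2] and [q], those of the old potential. *)
move=> Hp Hy; have E1 : (q + (a ^+ 2 - a' ^+ 2 + a')) * (p * ey + (1 - p) * ew) =
  (p * (q + (a ^+ 2 - a' ^+ 2 + a'))) * (ey - ew) + (q + (a ^+ 2 - a' ^+ 2 + a')) * ew by ring.
rewrite E1 Hp; lra.
Qed.

(** The potential at time 0, where all iterates equal [x1]; 36 is the square of [alpha 0]. *)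
Definition initial_potential : R :=
  (36 + atil) * D x1 + (2 * eta)^-1 * enorm (x1 - xs) ^+ 2.

Lemma potential_le t : potential t <= initial_potential.
Proof.
elim: t => [|t]; last exact: le_trans (potential_nonincreasing t).
rewrite /potential ckpt_weight0 alpha_early // /initial_potential enorm_sqr.
have E u (g : T -> R) : (forall o, g o = u) -> Ex 0 g = u.
  by move=> gu; rewrite -[RHS](Ex_cst indep o0 0 u); apply: eq_bigr => h _; rewrite gu.
rewrite (E (D x1)) => [|o]; last by have [_ -> _ _] := start run o.
rewrite (E (D x1)) => [|o]; last by have [_ _ _ ->] := start run o.
rewrite (E (dotv (x1 - xs) (x1 - xs))) => [|o]; last by have [_ _ -> _] := start run o.
lra.
Qed.

Lemma expected_gapE (v : nat -> T -> 'rV[R]_d) t :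
  (forall o, (l (v t.+1 o) < +oo)%E) -> determined J coin t (v t.+1) ->
  expected_gap P f l xs v t.+1 = (Ex t (fun o => D (v t.+1 o)))%:E.
Proof.
move=> lv dv; rewrite /expected_gap -(integral_Ex indep) => [|o o' /dv -> //].
by apply: eq_integral => o _; rewrite objective_gap.
Qed.

(** All three terms of the potential are nonnegative, and both gaps carry a weight of at least t^2 /
    16. *)
Lemma expected_gap_bound (v : nat -> T -> 'rV[R]_d) : v = y \/ v = w ->
  forall t, exists2 e : R, expected_gap P f l xs v t.+1 = e%:E &
    0 <= e /\ t%:R ^+ 2 / 16 * e <= initial_potential.
Proof.
move=> vyw t.
have [lv dv] : (forall o, (l (v t.+1 o) < +oo)%E) /\ determined J coin t (v t.+1).
  case: vyw => ->; split.
  - by move=> o; have [] := iterates_dom t o.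
  - by move=> o o' /determined_state[->].
  - by move=> o; have [] := iterates_dom t o.
  - by move=> o o' /determined_state[_ _ ->].
exists (Ex t (fun o => D (v t.+1 o))); first exact: expected_gapE.
split; first by apply: Ex_ge0 => o; apply: gap_at_ge0.
have ey : 0 <= Ex t (fun o => D (y t.+1 o)).
  by apply: Ex_ge0 => o; apply: gap_at_ge0; have [] := iterates_dom t o.
have ew : 0 <= Ex t (fun o => D (w t.+1 o)).
  by apply: Ex_ge0 => o; apply: gap_at_ge0; have [] := iterates_dom t o.
have ez : 0 <= (2 * eta)^-1 * Ex t (fun o => dotv (z t.+1 o - xs) (z t.+1 o - xs)).
  rewrite mulr_ge0 ?invr_ge0 ?mulr_ge0 // ?(ltW eta0) //.
  by apply: Ex_ge0 => o; apply: dotvv_ge0.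
apply: le_trans (potential_le t); rewrite /potential.
have Hy := ler_wpM2r ey (alpha_sqr_ge t).
have Hw := ler_wpM2r ew (ckpt_weight_ge atil_gt0 t).
have t0 : 0 <= t%:R ^+ 2 / 16 :> R by rewrite mulr_ge0 ?exprn_ge0 ?ler0n.
have Hy0 := mulr_ge0 t0 ey; have Hw0 := mulr_ge0 t0 ew.
case: vyw => ->; lra.
Qed.

Lemma expected_ifo_callsE N : expected_ifo_calls P n b coin N =
  (n%:R + \sum_(1 <= t < N.+1) (2 * b%:R + n%:R * ckpt_prob atil b t))%:E.
Proof.
rewrite /expected_ifo_calls unlock.
rewrite (integral_Ex indep o0 (t := N)); last first.
  move=> o o' /histP e; rewrite /ifo_calls; congr (_ + _)%:R.
  by apply: eq_big_nat => t; rewrite ltnS => /e[_ ->].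
congr EFin.
transitivity (Ex N (fun o => n%:R +
  \sum_(t <- index_iota 1 N.+1) (2 * b%:R + n%:R * (coin t o)%:R))).
  apply: eq_bigr => h _; congr (_ * _); rewrite natrD natr_sum; congr (_ + _).
  apply: eq_bigr => t _; rewrite natrD natrM; congr (_ + _).
  by case: (coin t _); rewrite ?mulr1 ?mulr0.
transitivity (Ex N (fun=> n%:R) +
  Ex N (fun o => \sum_(t <- index_iota 1 N.+1) (2 * b%:R + n%:R * (coin t o)%:R))).
  exact: ExD.
rewrite (Ex_cst indep) Ex_sum; congr (_ + _).
rewrite !big_seq; apply: eq_bigr => -[|t]; rewrite mem_index_iota // => /andP[_ tN].
rewrite ltnS in tN.
transitivity (Ex N (fun=> 2 * b%:R) + Ex N (fun o => n%:R * (coin t.+1 o)%:R)).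
  exact: ExD.
rewrite (Ex_cst indep) ExZ; congr (_ + _ * _).
rewrite (Ex_later indep o0 tN); last by move=> o o' /(determined_coin (n := n)) ->.
(* The coin's indicator is the choice between the constants 1 and 0. *)
have := @Ex_coin t (fun=> 1) (fun=> 0) (fun _ _ _ => erefl) (fun _ _ _ => erefl).
rewrite !(Ex_cst indep) mulr0 addr0 mulr1 => <-.
by apply: eq_bigr => h _; case: (coin _ _).
Qed.

(** Read off from the law of the coin rather than from the formula. *)
Lemma ckpt_prob_le1 t : ckpt_prob atil b t.+1 <= 1.
Proof.
rewrite -lee_fin; have := coin_law rd (isT : (1 <= t.+1)%N) => <-.
apply: probability_le1; apply: (@measurable_draw _ _ _ P _ J coin indep (inr t.+1)) => //.
by exists [set true].
Qed.

End Run.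

(** * Complexity *)

Lemma harmonic_sum_le (R : realType) N :
  \sum_(1 <= t < N.+1) t%:R^-1 <= 1 + ln N.+1%:R :> R.
Proof.
have tail M : \sum_(1 <= t < M.+2) t%:R^-1 <= 1 + ln M.+1%:R :> R.
  elim: M => [|M IH]; first by rewrite big_nat1 invr1 ln1 addr0.
  rewrite big_nat_recr //=; apply: le_trans (lerD IH (lexx _)) _.
  rewrite -addrA lerD2l.
  have m0 : 0 < M.+2%:R :> R by rewrite ltr0n.
  have m1 : 0 < M.+1%:R :> R by rewrite ltr0n.
  (* Bounds the new term of the sum by the increment of the logarithm. *)
  have : ln (1 + - M.+2%:R^-1) <= - M.+2%:R^-1 :> R.
    by apply: le_ln1Dx; rewrite ltrN2 invf_lt1 // ltr1n.
  have -> : 1 + - M.+2%:R^-1 = M.+1%:R / M.+2%:R :> R.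
    have E : M.+2%:R = M.+1%:R + 1 :> R by rewrite natr1.
    by rewrite E; move: m1; move: (M.+1%:R) => a a0; field; apply: lt0r_neq0; lra.
  rewrite lnM ?lnV ?posrE ?invr_gt0 //; move: (M.+2%:R^-1) => i; lra.
case: N => [|N]; first by rewrite big_geq // ln1 addr0 ler01.
apply: le_trans (tail N) _; rewrite lerD2l ler_ln ?posrE ?ltr0n //.
by rewrite ler_nat.
Qed.

(** * Convergence and iteration count from an inverse-square bound *)

Section IterationBound.
Context {R : realType}.
Variables (g : nat -> \bar R) (K : R).
Hypothesis K0 : 0 < K.
Hypothesis gK : forall t, exists2 e : R, g t.+1 = e%:E & 0 <= e /\ t%:R ^+ 2 / 16 * e <= K.

Lemma inverse_square_cvg0 : g t @[t --> \oo] --> 0%E.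
Proof.
(* One shift reaches the indices covered by [gK], the other makes the factor t^2 positive. *)
rewrite -cvg_shiftS -cvg_shiftS.
apply: cvg_EFin; first by near=> t; have [e /= -> _] := gK t.+1.
apply: (@squeeze_cvgr _ _ _ _ (fun=> 0) (fun t => 16 * K * harmonic t)).
- near=> t; have [e /= -> [e0 eK]] /= := gK t.+1; rewrite e0 /=.
  have t0 : 0 < t.+1%:R :> R by rewrite ltr0n.
  rewrite ler_pdivlMr //.
  have t1 : 1 <= t.+1%:R :> R by rewrite ler1n.
  have : t.+1%:R * e <= t.+1%:R ^+ 2 * e by rewrite ler_wpM2r // expr2 ler_peMr // ltW.
  by move: eK; lra.
- exact: cvg_cst.
- by rewrite -[X in _ --> X](mulr0 (16 * K)); apply: cvgMr; exact: cvg_harmonic.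
Unshelve. all: by end_near.
Qed.

Lemma first_accurate_le eps : 0 < eps ->
  exists2 N, first_accurate g eps N & N%:R <= 4 * Num.sqrt (K / eps) + 1.
Proof.
move=> eps0; set s := Num.sqrt (K / eps).
have s0 : 0 <= 4 * s by rewrite mulr_ge0 ?sqrtr_ge0.
(* [M] exceeds [4 * s], so [M^2 / 16] exceeds [K / eps] and the iterate [M + 1] is accurate; the
   first accurate index is at most [M]. *)
have /andP[M1 M2] := truncn_itv s0; set M := (Num.truncn (4 * s)).+1 in M2.
have Macc : (g M.+1 <= eps%:E)%E.
  have [e -> [e0 eK]] := gK M; rewrite lee_fin.
  have m0 : 0 < M%:R ^+ 2 / 16 :> R by rewrite divr_gt0 ?exprn_gt0 ?ltr0n.
  rewrite -(ler_pM2l m0); apply: (le_trans eK).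
  rewrite -ler_pdivrMr // -[K / eps]sqr_sqrtr ?divr_ge0 ?(ltW K0) ?(ltW eps0) // -/s.
  have : (4 * s) ^+ 2 <= M%:R ^+ 2 by rewrite lerXn2r ?nnegrE ?ler0n // ltW.
  lra.
have ex : exists N, (g N.+1 <= eps%:E)%E by exists M.
exists (ex_minn ex); case: ex_minnP => N accN minN.
  by split=> // m mN /minN; rewrite leqNgt mN.
apply: (@le_trans _ _ M%:R); first by rewrite ler_nat; apply: minN.
by rewrite /M -natr1 lerD2r.
Qed.

End IterationBound.

(** * Expected number of oracle calls *)

Section CallCount.
Context {R : realType}.
Variables (n b : nat) (atil : R).
Hypothesis atil0 : 0 < atil.
Hypothesis p1 : forall t, ckpt_prob atil b t.+1 <= 1.

Lemma sum_early_le N : \sum_(1 <= t < N.+1) (t <= 17)%:R <= 17 :> R.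
Proof.
rewrite -natr_sum (ler_nat _ _ 17).
have le1 M : (\sum_(1 <= t < M.+1) (t <= 17) <= M)%N.
  apply: leq_trans (_ : \sum_(1 <= t < M.+1) 1 <= M)%N.
    by apply: leq_sum => t _; case: (t <= 17)%N.
  by rewrite sum_nat_const_nat muln1 subn1.
have [N17|N17] := leqP N 17; first exact: leq_trans (le1 N) N17.
rewrite (big_cat_nat (n := 18)) //=; last by rewrite ltnS ltnW.
rewrite [X in (_ + X)%N]big_nat_cond [X in (_ + X)%N]big1 ?addn0 => [|t]; last first.
  by rewrite andbT => /andP[t17 _]; rewrite leqNgt t17.
exact: le1.
Qed.

(** Up to iteration 17 only [p <= 1] is used. The constant 21 counts the initial gradient, these 17
    iterations, and 3 from the harmonic sum weighted by 3. *)
Lemma call_count_le N :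
  n%:R + \sum_(1 <= t < N.+1) (2 * b%:R + n%:R * ckpt_prob atil b t) <=
  n%:R * (21 + 3 * ln N.+1%:R) + N%:R * (2 * b%:R + n%:R * xi b) :> R.
Proof.
have n0 := ler0n R n.
have H : \sum_(1 <= t < N.+1) (2 * b%:R + n%:R * ckpt_prob atil b t) <=
  \sum_(1 <= t < N.+1) ((2 * b%:R + n%:R * xi b) + n%:R * ((t <= 17)%:R + 3 * t%:R^-1)) :> R.
  rewrite big_nat [leRHS]big_nat; apply: ler_sum => t /andP[t1 _].
  rewrite -addrA lerD2l -mulrDr ler_wpM2l //.
  have i0 : 0 <= t%:R^-1 :> R by rewrite invr_ge0.
  have x0 := @xi_ge0 R b.
  have [t17|t17] := leqP t 17.
    by case: t t1 t17 i0 => // t _ _ i0; have := p1 t; rewrite /=;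
      move: (t.+1%:R^-1) i0 => i i0; lra.
  by have := ckpt_prob_late atil0 b t17; rewrite /= add0r addrC.
apply: le_trans (lerD (lexx _) H) _.
rewrite big_split /= sumr_const_nat subn1 -[_ *+ _]mulr_natl -mulr_sumr big_split /= -mulr_sumr.
have H1 := @harmonic_sum_le R N; have H2 := sum_early_le N.
have : n%:R * (\sum_(1 <= t < N.+1) (t <= 17)%:R + 3 * \sum_(1 <= t < N.+1) t%:R^-1) <=
   n%:R * (17 + 3 * (1 + ln N.+1%:R)) :> R by rewrite ler_wpM2l //; lra.
lra.
Qed.

End CallCount.

(** * The constant in the complexity bound *)

Section ComplexityConstant.
Context {R : realType}.
Variables (k1 k2 K eps0 : R).
Hypotheses (k10 : 0 < k1) (k12 : k1 <= k2) (K0 : 0 < K) (e00 : 0 < eps0) (e01 : eps0 < 1).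

Let A : R := 4 * Num.sqrt K + 2.
Let G : R := A * (2 * k2 + (3 * k1)^-1).

(** Dividing by [ln eps0^-1] and [ln 2], lower bounds for [ln eps^-1] and [ln n], lets the product
    of logarithms dominate constants and single logarithms. [A] bounds [N + 1] times [sqrt eps]; [G]
    bounds the cost of batches and of the [xi] part of the refreshes. *)
Definition complexity_const : R :=
  ((21 + 3 * ln A + G) / ln eps0^-1 + 3) / ln 2.

Let A2 : 2 <= A.
Proof. by rewrite lerDr mulr_ge0 ?sqrtr_ge0. Qed.

Let G0 : 0 <= G.
Proof.
have k20 : 0 <= k2 by rewrite (le_trans (ltW k10)).
rewrite mulr_ge0 ?(le_trans _ A2) // addr_ge0 ?mulr_ge0 // invr_ge0 mulr_ge0 // ltW //.
Qed.

Let lnA0 : 0 <= ln A.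
Proof. by apply: ln_ge0; apply: le_trans A2; rewrite ler1n. Qed.

Let l0 : 0 < ln eps0^-1.
Proof. by apply: ln_gt0; rewrite invf_gt1. Qed.

Let ln20 : 0 < ln 2 :> R.
Proof. by apply: ln_gt0; rewrite ltr1n. Qed.

Lemma complexity_const_gt0 : 0 < complexity_const.
Proof.
rewrite divr_gt0 // ltr_wpDl // divr_ge0 ?(ltW l0) //.
by move: lnA0 G0; lra.
Qed.

Lemma complexity_bound (n b N : nat) eps :
  (2 <= n)%N -> (1 <= b)%N ->
  k1 * Num.sqrt n%:R <= b%:R -> b%:R <= k2 * Num.sqrt n%:R ->
  0 < eps -> eps <= eps0 -> N%:R <= 4 * Num.sqrt (K / eps) + 1 ->
  n%:R * (21 + 3 * ln N.+1%:R) + N%:R * (2 * b%:R + n%:R * xi b) <=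
  complexity_const * (n%:R + Num.sqrt n%:R / Num.sqrt eps) * (ln n%:R * ln eps^-1).
Proof.
move=> n2 b1 bk1 bk2 e0 ee0 HN.
have n0 : 0 < n%:R :> R by rewrite ltr0n ltnW.
set r := Num.sqrt n%:R.
have r0 : 0 < r by rewrite sqrtr_gt0.
have rr : n%:R = r * r by rewrite -expr2 sqr_sqrtr // ltW.
set S := (Num.sqrt eps)^-1.
have se0 : 0 < Num.sqrt eps by rewrite sqrtr_gt0.
have se1 : Num.sqrt eps <= 1.
  by rewrite -sqrtr1 ler_wsqrtr // (le_trans ee0) // ltW.
have S1 : 1 <= S by rewrite invf_ge1.
have Seps : S <= eps^-1.
  rewrite lef_pV2 ?posrE // -[leLHS]sqr_sqrtr ?(ltW e0) // expr2.
  by rewrite ler_piMr // ltW.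
have NA : N.+1%:R <= A * S.
  rewrite -natr1; apply: le_trans (lerD HN (lexx _)) _.
  by rewrite sqrtrM ?(ltW K0) // sqrtrV ?(ltW e0) // -/S /A; lra.
have A0 : 0 < A by apply: lt_le_trans A2.
have S0 : 0 < S by apply: lt_le_trans S1.
have lnN : ln N.+1%:R <= ln A + ln eps^-1.
  apply: (@le_trans _ _ (ln (A * S))); first by rewrite ler_ln ?posrE ?ltr0n // mulr_gt0.
  by rewrite lnM ?posrE // lerD2l ler_ln ?posrE // invr_gt0.
(* Here [b >= k1 sqrt n] enters: refreshes of rate [xi <= 1 / (3 b)] cost only order [sqrt n] per
   iteration. *)
have xin : n%:R * xi b <= (3 * k1)^-1 * r.
  apply: le_trans (ler_wpM2l (ltW n0) (xi_le b)) _.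
  have kr : 0 < k1 * r by rewrite mulr_gt0.
  have : (3 * b%:R)^-1 <= (3 * (k1 * r))^-1.
    by rewrite lef_pV2 ?posrE ?mulr_gt0 ?ltr0n // ler_pM2l.
  move=> /(ler_wpM2l (ltW n0)) /le_trans; apply.
  by rewrite rr le_eqVlt; apply/orP; left; apply/eqP; field; rewrite !lt0r_neq0.
have NA' : N%:R <= A * S by apply: le_trans NA; rewrite ler_nat.
have T2 : N%:R * (2 * b%:R + n%:R * xi b) <= G * (r * S).
  have q0 : 0 <= 2 * b%:R + n%:R * xi b :> R.
    apply: addr_ge0; first by rewrite mulr_ge0.
    by apply: mulr_ge0; [exact: ltW|exact: xi_ge0].
  apply: le_trans (ler_wpM2r q0 NA') _.
  have -> : G * (r * S) = A * S * (2 * (k2 * r) + (3 * k1)^-1 * r) by rewrite /G; ring.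
  by rewrite ler_pM2l ?mulr_gt0 // lerD // ler_pM2l.
have T1 : n%:R * (21 + 3 * ln N.+1%:R) <= n%:R * (21 + 3 * ln A + 3 * ln eps^-1).
  by rewrite ler_pM2l //; lra.
apply: le_trans (lerD T1 T2) _.
set lam := ln eps^-1.
have lam0 : ln eps0^-1 <= lam by rewrite ler_ln ?posrE ?invr_gt0 // lef_pV2 ?posrE.
have lamp : 0 < lam by apply: lt_le_trans lam0.
have lnn : ln 2 <= ln n%:R :> R by rewrite ler_ln ?posrE // ler_nat.
have P0 : 0 <= n%:R + r * S by apply: addr_ge0; [exact: ltW|apply: mulr_ge0; exact: ltW].
have C1 : 21 + 3 * ln A + G + 3 * lam <= complexity_const * (ln n%:R * lam).
  have B0 : 0 <= 21 + 3 * ln A + G by move: lnA0 G0; lra.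
  apply: (@le_trans _ _ (complexity_const * (ln 2 * lam))); last first.
    by rewrite ler_pM2l ?complexity_const_gt0 // ler_pM2r.
  have -> : complexity_const * (ln 2 * lam) =
     (21 + 3 * ln A + G) * (lam / ln eps0^-1) + 3 * lam.
    by rewrite /complexity_const; field; rewrite !lt0r_neq0.
  by rewrite lerD2r ler_peMr // ler_pdivlMr // mul1r.
rewrite -/S [leRHS]mulrAC [leRHS]mulrC.
(* The product adds only the nonnegative cross terms [X1] and [X2]. *)
apply: (@le_trans _ _ ((n%:R + r * S) * (21 + 3 * ln A + G + 3 * lam))); last first.
  by rewrite ler_wpM2l.
have X1 : 0 <= n%:R * G by apply: mulr_ge0 => //; exact: ltW.
have X2 : 0 <= r * S * (21 + 3 * ln A + 3 * lam).
  by rewrite mulr_ge0 ?mulr_ge0 ?(ltW r0) ?(ltW S0) //; move: lnA0 lamp; lra.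
lra.
Qed.

End ComplexityConstant.

Theorem corollary2 (R : realType) :
  exists k : nat,
  forall (k1 k2 L eta atil gap dist eps0 : R),
    0 < k1 -> k1 <= k2 -> 0 < L -> 0 < eta -> 0 < eps0 -> eps0 < 1 ->
  exists C : R, 0 < C /\
  forall (n d b : nat) (f : 'I_n -> 'rV[R]_d -> R) (l : 'rV[R]_d -> \bar R)
         (xstar x1 : 'rV[R]_d)
         (disp : measure_display) (T : measurableType disp)
         (P : probability T R)
         (J : nat -> T -> {set 'I_n}) (coin : nat -> T -> bool)
         (x y z w : nat -> T -> 'rV[R]_d),
    (1 <= b <= n)%N ->
    k1 * Num.sqrt n%:R <= b%:R -> b%:R <= k2 * Num.sqrt n%:R ->
    eta <= (cpar b * L + L)^-1 ->
    xi b * alpha 1 ^+ 2 <= atil ->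
    problem_assumptions f l L xstar ->
    random_draws P b (ckpt_prob atil b) J coin ->
    algorithm_run f l b eta x1 J coin x y z w ->
    (objective f l x1 - objective f l xstar = gap%:E)%E ->
    enorm (x1 - xstar) = dist ->
    [/\ expected_gap P f l xstar y t @[t --> \oo] --> 0%E,
        expected_gap P f l xstar w t @[t --> \oo] --> 0%E
      & (2 <= n)%N -> forall eps : R, 0 < eps -> eps <= eps0 ->
        let bound := C * (n%:R + Num.sqrt n%:R / Num.sqrt eps) *
                     (ln n%:R * ln eps^-1) ^+ k in
        ifo_complexity_le P n b coin (expected_gap P f l xstar y) eps bound /\
        ifo_complexity_le P n b coin (expected_gap P f l xstar w) eps bound].
Proof.
(* A single power of the product of the two logarithms suffices. *)
exists 1%N => k1 k2 L eta atil gap dist eps0 k10 k12 L0 eta0 e00 e01.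
(* Bounds the initial potential. It is chosen before the signs of [atil] and [gap] are known, hence
   the absolute values; adding 1 makes it positive. *)
pose K := (36 + `|atil|) * `|gap| + (2 * eta)^-1 * dist ^+ 2 + 1.
have K0 : 0 < K.
  rewrite ltr_wpDl // addr_ge0 // mulr_ge0 ?addr_ge0 ?sqr_ge0 //.
  by rewrite invr_ge0 mulr_ge0 // ltW.
exists (complexity_const k1 k2 K eps0); split; first exact: complexity_const_gt0.
move=> n d b f l xs x1 disp T P J coin x y z w bn bk1 bk2 etaL at0 pa rd run gapE distE.
(* A space of total mass 1 has a point, the default representative of empty atoms. *)
have [p _] : [set: T] !=set0.
  apply/set0P/eqP => E; have := probability_setT P; rewrite E measure0.
  by move/eqP; rewrite eq_sym onee_eq0.
have gapK v : v = y \/ v = w -> forall t, exists2 e : R,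
    expected_gap P f l xs v t.+1 = e%:E & 0 <= e /\ t%:R ^+ 2 / 16 * e <= K.
  move=> vyw t.
  have [e -> [e0 eK]] := expected_gap_bound p bn L0 eta0 etaL at0 pa rd run vyw t.
  exists e => //; split=> //; apply: (le_trans eK); rewrite /initial_potential distE.
  have := objective_gap pa run (start_dom pa run); rewrite gapE => -[<-].
  apply: (@le_trans _ _ ((36 + `|atil|) * `|gap| + (2 * eta)^-1 * dist ^+ 2)).
    2: by rewrite lerDl.
  rewrite lerD2r.
  have a0 := atil_gt0 bn at0.
  by rewrite (gtr0_norm a0) ler_wpM2l ?ler_norm // addr_ge0 // ltW.
split.
- by apply: (inverse_square_cvg0 (gapK y _)); left.
- by apply: (inverse_square_cvg0 (gapK w _)); right.
move=> n2 eps eps_gt0 eps_le bound.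
suff main v : v = y \/ v = w ->
    ifo_complexity_le P n b coin (expected_gap P f l xs v) eps bound.
  by split; apply: main; [left|right].
move=> vyw; have [N accN HN] := first_accurate_le K0 (gapK v vyw) eps_gt0.
exists N; split=> //; rewrite (expected_ifo_callsE p rd) lee_fin.
have b1 : (1 <= b)%N by case/andP: bn.
apply: le_trans (call_count_le n (atil_gt0 bn at0) (ckpt_prob_le1 rd) N) _.
by rewrite /bound expr1; apply: complexity_bound.
Qed.
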